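(* Suppose that the Lipschitz/boundedness assumption in the context holds for the block-structured constrained convex problem (P) and that $(x^*,y^*,z^* )$ is a KKT point of (P). Let $\{w^k\}=\{(x^k,y^k,z^k)\}$ be the (random) sequence generated by the block linearized augmented Lagrangian method (BLALM, described in the context) with $x^0\in\mathrm{dom}(h)$, $y^0=0$ and $z^0=0$. Assume that the block Lipschitz constants $\ell_i^k$ of the context satisfy $\ell_i^k\le\bar\ell_i$ for all $i\in\{1,\dots,n\}$ and all $k$, with constants $\bar\ell_i$. If $\rho_y\in(0,\frac\beta n]$, $\rho_z\in(0,\frac\beta{2n}]$ and $\eta_i\ge\bar\ell_i+\beta\|A_i\|^2$ for all $i\in\{1,\dots,n\}$, then for every $k\ge0$, $$\big|\mathbb E[f_0(\bar x^{k+1})-f_0(x^* )]\big|\le\frac1{1+\frac kn}\left(C_{x^0}+\frac{2\|y^*\|^2}{n\rho_y}+\frac{2\|z^*\|^2}{n\rho_z}\right),$$ $$\mathbb E\left[\|A\bar x^{k+1}-b\|+\sum_{j=1}^m[f_j(\bar x^{k+1})]_+\right]\le\frac1{1+\frac kn}\left(C_{x^0}+\frac{(1+\|y^*\|)^2}{2n\rho_y}+\frac1{2n\rho_z}\sum_{j=1}^m(1+z_j^* )^2\right),$$ where $\bar x^{k+1}=\frac1{1+\frac kn}\Big(x^{k+1}+\frac1n\sum_{t=0}^{k-1}x^{t+1}\Big)$ and $$C_{x^0}=\Big(1-\frac1n\Big)\left[f_0(x^0)-f_0(x^* )+\frac\beta2\Big(\|Ax^0-b\|^2+\sum_{j=1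}^m[f_j(x^0)]_+^2\Big)\right]+\frac12\sum_{i=1}^n\eta_i\|x_i^0-x_i^*\|^2.$$
   Context: Problem (P): $\min_{x\in\mathbb R^p} f_0(x):=g(x)+h(x)$ subject to $Ax=b$, $f_j(x)\le 0$ for $j=1,\dots,m$, where $b\in\mathbb R^q$, $A\in\mathbb R^{q\times p}$, $g,f_1,\dots,f_m:\mathbb R^p\to\mathbb R$ are convex and differentiable with Lipschitz gradients, and $h:\mathbb R^p\to(-\infty,+\infty]$ is proper, closed and convex. The variable is partitioned into $n$ disjoint blocks $x=(x_1,\dots,x_n)$, $h(x)=\sum_{i=1}^nh_i(x_i)$ is block separable, and correspondingly $A=[A_1,\dots,A_n]$. $\|\cdot\|$ is the Euclidean norm (spectral norm for matrices); $[a]_+=\max(0,a)$. KKT point: $w=(x,y,z)$ is a KKT point of (P) if $0\in\nabla g(x)+\partial h(x)+A^\top y+\sum_{j=1}^m z_j\nabla f_j(x)$, $Ax=b$, and $z_j\ge0$, $f_j(x)\le0$, $z_jf_j(x)=0$ for all $j$. Lipschitz/boundedness assumption: there are constants $L_g,L_1,\dots,L_m,B_1,\dots,B_m\ge 0$ such that for all $\hat x,\tilde x\in\mathrm{dom}(h)$ and all $j$: $\|\nabla g(\hat x)-\nabla g(\tilde x)\|\le L_g\|\hat x-\tilde x\|$, $\|\nabla f_j(\hat x)-\nabla f_j(\tilde x)\|\le L_j\|\hat x-\tilde x\|$, and $\|\nabla f_j(\hat x)\|\le B_j$. Augmented Lagrangian: for $\beta>0$, let $\psi_\beta(u,v)=uv+\frac\beta2u^2$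 if $\beta u+v\ge0$ and $\psi_\beta(u,v)=-\frac{v^2}{2\beta}$ if $\beta u+v<0$; $\Psi_\beta(x,z)=\sum_{j=1}^m\psi_\beta(f_j(x),z_j)$; $F_\beta(x,y,z)=g(x)+y^\top(Ax-b)+\frac\beta2\|Ax-b\|^2+\Psi_\beta(x,z)$. BLALM: given $\beta,\rho_y,\rho_z>0$, $\eta_1,\dots,\eta_n>0$ and $w^0=(x^0,y^0,z^0)$, for $k=0,1,\dots$ pick $i_k\in\{1,\dots,n\}$ uniformly at random (independently of the past) and set $$x_{i_k}^{k+1}=\arg\min_{x_{i_k}}\;h_{i_k}(x_{i_k})+\langle\nabla_{x_{i_k}}F_\beta(w^k),x_{i_k}\rangle+\frac{\eta_{i_k}}2\|x_{i_k}-x_{i_k}^k\|^2,\qquad x_i^{k+1}=x_i^k\ (i\ne i_k),$$ $$y^{k+1}=y^k+\rho_y(Ax^{k+1}-b),\qquad z_j^{k+1}=z_j^k+\rho_z\max\Big(-\frac{z_j^k}\beta,f_j(x^{k+1})\Big),\ j=1,\dots,m.$$ Block Lipschitz constants: $\ell_i^k$ is the Lipschitz constant of $\nabla_{x_i}G_k$ with respect to $x_i$ at the current iterate, where $G_k(x)=g(x)+\Psi_\beta(x,z^k)$; that is, $\ell_i^k\ge0$ is a number, determined by $w^k$, with $\|\nabla_{x_i}G_k(\hat x)-\nabla_{x_i}G_k(x^k)\|\le\ell_i^k\|\hat x_i-x_i^k\|$ for all $\hat x\in\mathrm{dom}(h)$ that differ from $x^k$ only in block $i$. *)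

(* Defs.v *)
From mathcomp Require Import all_boot all_order all_algebra.
From mathcomp Require Import finmap.
From mathcomp Require Import all_classical all_reals all_analysis.

Set Implicit Arguments.
Unset Strict Implicit.
Unset Printing Implicit Defensive.

Import Order.TTheory GRing.Theory Num.Theory.
Import numFieldNormedType.Exports.

Local Open Scope classical_set_scope.
Local Open Scope ring_scope.

Section Euclidean.
Context {R : realType}.

Definition dotv (k : nat) (u v : 'cV[R]_k) : R := \sum_j u j 0 * v j 0.

(* The library norm `|u| on matrices is the sup norm, not the Euclidean one.  *)
Definition enorm (k : nat) (u : 'cV[R]_k) : R := Num.sqrt (\sum_j u j 0 ^+ 2).

Definition spectral_norm (k l : nat) (M : 'M[R]_(k, l)) : R :=
  sup [set enorm (M *m v) | v in [set v : 'cV[R]_l | enorm v <= 1]].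

Definition pospart (a : R) : R := Num.max 0 a.

Definition grad (k : nat) (f : 'cV[R]_k -> R) (x : 'cV[R]_k) : 'cV[R]_k :=
  \col_j 'D_(delta_mx j 0) f x.

Definition grad_lipschitz_on (k : nat) (D : set 'cV[R]_k) (f : 'cV[R]_k -> R)
    (L : R) : Prop :=
  forall xh xt, D xh -> D xt ->
    enorm (grad f xh - grad f xt) <= L * enorm (xh - xt).

Definition convex_smooth (k : nat) (f : 'cV[R]_k -> R) : Prop :=
  [/\ convex_function [set: convex_lmodType 'cV[R]_k] f,
      forall x, differentiable f x
    & exists L : R, grad_lipschitz_on [set: 'cV[R]_k] f L].

(* Extended-value functions 'cV_k -> (-oo, +oo] are modelled in \bar R; the   *)
(* value -oo is excluded by [proper_fun].                                     *)

Definition edom (k : nat) (h : 'cV[R]_k -> \bar R) : set 'cV[R]_k :=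
  [set x | (h x < +oo)%E].

Definition proper_fun (k : nat) (h : 'cV[R]_k -> \bar R) : Prop :=
  (edom h !=set0) /\ (forall x, (-oo < h x)%E).

Definition closed_fun (k : nat) (h : 'cV[R]_k -> \bar R) : Prop :=
  closed [set xr : 'cV[R]_k * R | (h xr.1 <= xr.2%:E)%E].

Definition convex_efun (k : nat) (h : 'cV[R]_k -> \bar R) : Prop :=
  forall (x y : 'cV[R]_k) (t : R), 0 <= t -> t <= 1 ->
    (h (t *: x + (1 - t) *: y)%R <= t%:E * h x + (1 - t)%:E * h y)%E.

Definition subdiff (k : nat) (h : 'cV[R]_k -> \bar R) (x : 'cV[R]_k) :
    set 'cV[R]_k :=
  [set v | forall u, (h x + (dotv v (u - x))%:E <= h u)%E].

Definition is_argmin (k : nat) (phi : 'cV[R]_k -> \bar R) (u : 'cV[R]_k) :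
    Prop :=
  forall v, (phi u <= phi v)%E.

End Euclidean.

(* The variable is x : 'cV_(\sum_i p_ i); its i-th block is                   *)
(* x_i = submxcol x i : 'cV_(p_ i), and A_i = submxrow A i.                   *)
Record problem (R : realType) (n : nat) (p_ : 'I_n -> nat) (q m : nat) :=
  Problem {
    gfun : 'cV[R]_(\sum_i p_ i) -> R ;
    hblock : forall i : 'I_n, 'cV[R]_(p_ i) -> \bar R ;
    fcon : 'I_m -> 'cV[R]_(\sum_i p_ i) -> R ;
    Amat : 'M[R]_(q, \sum_i p_ i) ;
    bvec : 'cV[R]_q }.

Record iterate (R : realType) (n : nat) (p_ : 'I_n -> nat) (q m : nat) :=
  Iterate {
    xpart : 'cV[R]_(\sum_i p_ i) ;
    ypart : 'cV[R]_q ;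
    zpart : 'cV[R]_m }.

Section Blalm.
Context {R : realType} {n : nat} {p_ : 'I_n -> nat} {q m : nat}.
Variable pb : problem R p_ q m.

Local Notation X := ('cV[R]_(\sum_i p_ i)).
Local Notation g := (gfun pb).
Local Notation f := (fcon pb).
Local Notation A := (Amat pb).
Local Notation b := (bvec pb).

Definition hfun (x : X) : \bar R := (\sum_i hblock pb (submxcol x i))%E.

Definition f0 (x : X) : \bar R := ((g x)%:E + hfun x)%E.

Definition resid (x : X) : 'cV[R]_q := A *m x - b.

Definition convex_problem : Prop :=
  [/\ convex_smooth g,
      forall j, convex_smooth (f j)
    & [/\ proper_fun hfun, closed_fun hfun & convex_efun hfun]].

Definition lipschitz_bounded (Lg : R) (L B : 'I_m -> R) : Prop :=
  [/\ 0 <= Lg, forall j, 0 <= L j, forall j, 0 <= B j &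
  [/\ grad_lipschitz_on (edom hfun) g Lg,
      forall j, grad_lipschitz_on (edom hfun) (f j) (L j)
    & forall j x, edom hfun x -> enorm (grad (f j) x) <= B j]].

Definition KKT (w : iterate R p_ q m) : Prop :=
  let: Iterate x y z := w in
  [/\ exists2 v, subdiff hfun x v &
        grad g x + v + A^T *m y + \sum_j z j 0 *: grad (f j) x = 0,
      A *m x = b
    & forall j, [/\ 0 <= z j 0, f j x <= 0 & z j 0 * f j x = 0]].

Definition psi (beta u v : R) : R :=
  if 0 <= beta * u + v then u * v + beta / 2 * u ^+ 2
  else - (v ^+ 2 / (2 * beta)).

Definition Psi (beta : R) (x : X) (z : 'cV[R]_m) : R :=
  \sum_j psi beta (f j x) (z j 0).

Definition Faug (beta : R) (x : X) (y : 'cV[R]_q) (z : 'cV[R]_m) : R :=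
  g x + dotv y (resid x) + beta / 2 * enorm (resid x) ^+ 2 + Psi beta x z.

Definition Gaug (beta : R) (z : 'cV[R]_m) (x : X) : R := g x + Psi beta x z.

Definition block_lipschitz (beta : R) (w : iterate R p_ q m) (i : 'I_n)
    (l : R) : Prop :=
  let: Iterate x _ z := w in
  forall xh : X, edom hfun xh ->
    (forall i', i' != i -> submxcol xh i' = submxcol x i') ->
    enorm (submxcol (grad (Gaug beta z) xh) i
           - submxcol (grad (Gaug beta z) x) i)
      <= l * enorm (submxcol xh i - submxcol x i).

Definition blalm_step (beta rhoy rhoz : R) (eta : 'I_n -> R)
    (w : iterate R p_ q m) (i : 'I_n) (w' : iterate R p_ q m) : Prop :=
  let: Iterate x y z := w in
  let: Iterate x' y' z' := w' in
  [/\ is_argmin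
        (fun u : 'cV[R]_(p_ i) =>
           (hblock pb u +
            (dotv (submxcol (grad (fun v => Faug beta v y z) x) i) u
             + eta i / 2 * enorm (u - submxcol x i) ^+ 2)%:E)%E)
        (submxcol x' i),
      forall i', i' != i -> submxcol x' i' = submxcol x i',
      y' = y + rhoy *: resid x'
    & forall j, z' j 0 = z j 0 + rhoz * Num.max (- (z j 0 / beta)) (f j x')].

Definition blalm_sequence (T : Type) (I : nat -> T -> 'I_n)
    (beta rhoy rhoz : R) (eta : 'I_n -> R) (x0 : X)
    (w : nat -> T -> iterate R p_ q m) : Prop :=
  forall om, w 0%N om = Iterate x0 0 0 /\
    forall k, blalm_step beta rhoy rhoz eta (w k om) (I k om) (w k.+1 om).

(* [xavg w k om] is the average \bar x^{k+1} along the outcome om. *)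
Definition xavg (T : Type) (w : nat -> T -> iterate R p_ q m) (k : nat)
    (om : T) : X :=
  (1 + k%:R / n%:R)^-1 *:
    (xpart (w k.+1 om) + n%:R^-1 *: \sum_(t < k) xpart (w t.+1 om)).

Definition Cconst (beta : R) (eta : 'I_n -> R) (x0 xs : X) : \bar R :=
  ((1 - n%:R^-1)%:E *
     (f0 x0 - f0 xs
      + (beta / 2 * (enorm (resid x0) ^+ 2
                     + \sum_j pospart (f j x0) ^+ 2))%:E)
   + (2^-1 * \sum_i eta i * enorm (submxcol x0 i - submxcol xs i) ^+ 2)%:E)%E.

End Blalm.

Section Sampling.
Context {d : measure_display} {T : measurableType d} {R : realType}.
Variables (P : probability T R) (n : nat).

Definition iid_uniform (I : nat -> T -> 'I_n) : Prop :=
  [/\ forall k (S : set 'I_n), measurable (I k @^-1` S),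
      forall k i, P (I k @^-1` [set i]) = (n%:R^-1)%:E
    & forall (K : {fset nat}) (S : nat -> set 'I_n),
        P (\bigcap_(k in [set` K]) (I k @^-1` S k))
          = (\prod_(k <- K) fine (P (I k @^-1` S k)))%:E].

End Sampling.

(* Main.v *)
Require Import Defs.
From mathcomp Require Import all_boot all_order all_algebra.
From mathcomp Require Import finmap.
From mathcomp Require Import all_classical all_reals all_analysis.
From mathcomp Require Import ring lra.

Set Implicit Arguments.
Unset Strict Implicit.
Unset Printing Implicit Defensive.

Import Order.TTheory GRing.Theory Num.Theory.
Import numFieldNormedType.Exports.

Local Open Scope classical_set_scope.
Local Open Scope ring_scope.

(* Condition on the history of sampled blocks and average over the next one.  *)
(* The proximal optimality condition of block i, the block descent lemma      *)
(* (eta_i >= l_i + beta |A_i|^2) and convexity of the augmented Lagrangian    *)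
(* show that                                                                  *)
(*   merit(x', y, z) + |x' - x*|_eta^2 / 2                                    *)
(* decreases on average by at least (merit(x, y, z) + beta/2 |A x - b|^2) / n,*)
(* i.e. that the one-step [gain] has nonpositive conditional mean.            *)
(* Along every single trajectory the dual updates telescope: for all lam and  *)
(* mu >= 0, the initial constant C plus the sum of the gains is at least the  *)
(* weighted sum of the Lagrangian at (lam, mu) along the iterates, minus      *)
(* (|lam|^2 / rhoy + |mu|^2 / rhoz) / (2 n). As this                          *)
(* bound is pathwise, lam and mu may depend on the outcome: they are taken    *)
(* aligned with the residual and the violated constraints at the average, and *)
(* the KKT inequality converts the result into the two claims. The iterates   *)
(* are functions of the history, because the proximal step has a unique       *)
(* minimiser, so all expectations are finite sums.                            *)

(** Sampling one block uniformly performs, on average, one n-th of a full proximal gradient step on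
    the augmented Lagrangian. Up to the decrease of [wdist], the mean of the new [merit] is then at
    most the fraction 1 - 1/n of the old one: this is [gain_sum_le0], which rests on
    [prox_three_point], [block_descent] and [grad_Faug_le]. Adding these relations leaves weight 1
    on the last iterate and 1/n on each earlier one, the weights of the average.

    The dual updates are ascent steps. [merit_ge_lagr] bounds the merit below by a Lagrangian gap, a
    telescoping distance of multipliers and squared residuals; [merit_dual_step] bounds what an
    update adds, again by squared residuals. The bounds on rho_y and rho_z let the former squares
    absorb the latter in [gain_sum_ge]. Equality constraints bring a further surplus beta/2 |Ax -
    b|^2 from [grad_Faug_le], which is why rho_y may be twice as large as rho_z.

    Since [gain_sum_ge] holds on every trajectory, [traj_avg_bound] chooses multipliers of sizes c
    and d_j after seeing the outcome and turns the Lagrangian into an exact penalty. The choices c =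
    0, d = 0, then c = 2 |ys|, d = 2 zs, then c = 1 + |ys|, d = 1 + zs, the last two combined with
    the saddle point inequality [KKT_gap_ge], give the upper and lower bounds on the objective gap
    and the bound on infeasibility. Finally [integral_sample_le0] and [integral_le_drift] discard
    the gains in expectation. *)

Section EuclideanVectors.
Context {R : realType}.

Lemma dotvE k (u v : 'cV[R]_k) : dotv u v = (u^T *m v) 0 0.
Proof. by rewrite mxE; apply: eq_bigr => j _; rewrite mxE. Qed.

Lemma dotvC k (u v : 'cV[R]_k) : dotv u v = dotv v u.
Proof. by apply: eq_bigr => j _; rewrite mulrC. Qed.

Lemma dotvDl k (u v w : 'cV[R]_k) : dotv (u + v) w = dotv u w + dotv v w.
Proof. by rewrite -big_split; apply: eq_bigr => j _; rewrite mxE mulrDl. Qed.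

Lemma dotvDr k (u v w : 'cV[R]_k) : dotv w (u + v) = dotv w u + dotv w v.
Proof. by rewrite dotvC dotvDl !(dotvC w). Qed.

Lemma dotvZl k a (u v : 'cV[R]_k) : dotv (a *: u) v = a * dotv u v.
Proof. by rewrite mulr_sumr; apply: eq_bigr => j _; rewrite mxE mulrA. Qed.

Lemma dotvZr k a (u v : 'cV[R]_k) : dotv u (a *: v) = a * dotv u v.
Proof. by rewrite dotvC dotvZl dotvC. Qed.

Lemma dotvNl k (u v : 'cV[R]_k) : dotv (- u) v = - dotv u v.
Proof. by rewrite -scaleN1r dotvZl mulN1r. Qed.

Lemma dotvNr k (u v : 'cV[R]_k) : dotv u (- v) = - dotv u v.
Proof. by rewrite dotvC dotvNl dotvC. Qed.

Lemma dot0v k (v : 'cV[R]_k) : dotv 0 v = 0.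
Proof. by rewrite -(scale0r 0) dotvZl mul0r. Qed.

Lemma dotv_suml k (I : finType) (F : I -> 'cV[R]_k) v :
  dotv (\sum_i F i) v = \sum_i dotv (F i) v.
Proof.
elim/big_rec2 : _ => [|i a b _ <-]; first by rewrite dot0v.
by rewrite dotvDl.
Qed.

Lemma dotv_delta k (u : 'cV[R]_k) j : dotv u (delta_mx j 0) = u j 0.
Proof.
rewrite /dotv (bigD1 j)//= big1 => [|i ij].
  by rewrite !mxE !eqxx mulr1 addr0.
by rewrite !mxE (negbTE ij) mulr0.
Qed.

Lemma dotv_trmx k l (M : 'M[R]_(k, l)) u v : dotv (M^T *m u) v = dotv u (M *m v).
Proof. by rewrite !dotvE trmx_mul trmxK mulmxA. Qed.

Lemma enorm_sqr k (u : 'cV[R]_k) : enorm u ^+ 2 = dotv u u.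
Proof.
rewrite sqr_sqrtr; last by apply: sumr_ge0 => j _; exact: sqr_ge0.
by apply: eq_bigr => j _; rewrite expr2.
Qed.

Lemma enorm_ge0 k (u : 'cV[R]_k) : 0 <= enorm u.
Proof. exact: sqrtr_ge0. Qed.

Lemma dotv_ge0 k (u : 'cV[R]_k) : 0 <= dotv u u.
Proof. by rewrite -enorm_sqr sqr_ge0. Qed.

Lemma enorm_eq0 k (u : 'cV[R]_k) : (enorm u == 0) = (u == 0).
Proof.
rewrite -sqrf_eq0 enorm_sqr; apply/eqP/eqP => [|->]; last exact: dot0v.
rewrite /dotv; under eq_bigr do rewrite -expr2.
move/eqP; rewrite psumr_eq0 => [/allP u0|j _]; last exact: sqr_ge0.
apply/colP => j; rewrite mxE; apply/eqP.
by rewrite -sqrf_eq0; exact: (u0 j (mem_index_enum j)).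
Qed.

Lemma enorm0 k : enorm (0 : 'cV[R]_k) = 0.
Proof. by apply/eqP; rewrite enorm_eq0. Qed.

Lemma enormZ k a (u : 'cV[R]_k) : enorm (a *: u) = `|a| * enorm u.
Proof.
apply/eqP; rewrite -(@eqrXn2 _ 2)// ?mulr_ge0 ?enorm_ge0//.
by rewrite exprMn !enorm_sqr dotvZl dotvZr real_normK ?num_real// mulrA expr2.
Qed.

Lemma enormN k (u : 'cV[R]_k) : enorm (- u) = enorm u.
Proof. by rewrite -scaleN1r enormZ normrN1 mul1r. Qed.

Lemma dotv_le k (u v : 'cV[R]_k) : dotv u v <= enorm u * enorm v.
Proof.
have [->|u0] := eqVneq u 0; first by rewrite dot0v mulr_ge0// enorm_ge0.
have [->|v0] := eqVneq v 0.
  by rewrite dotvC dot0v mulr_ge0// enorm_ge0.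
have nu : 0 < enorm u by rewrite lt_neqAle eq_sym enorm_eq0 u0 enorm_ge0.
have nv : 0 < enorm v by rewrite lt_neqAle eq_sym enorm_eq0 v0 enorm_ge0.
have := dotv_ge0 (enorm v *: u - enorm u *: v).
rewrite !(dotvDl, dotvDr, dotvNl, dotvNr, dotvZl, dotvZr) (dotvC v u).
rewrite -!enorm_sqr.
rewrite [leRHS](_ : _ =
   2 * (enorm u * enorm v) * (enorm u * enorm v - dotv u v)); last by ring.
by rewrite pmulr_rge0 ?mulr_gt0// subr_ge0.
Qed.

Lemma enormD_sqr k (u v : 'cV[R]_k) :
  enorm (u + v) ^+ 2 = enorm u ^+ 2 + 2 * dotv u v + enorm v ^+ 2.
Proof.
rewrite !enorm_sqr !(dotvDl, dotvDr) (dotvC v u); ring.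
Qed.

(** The supremum in [spectral_norm] is an upper bound only once its set is known to be bounded; the
    Frobenius norm bounds it. The claim follows by normalising [v]. *)
Lemma enorm_mulmx_le k l (M : 'M[R]_(k, l)) v :
  enorm (M *m v) <= spectral_norm M * enorm v.
Proof.
have nM u : enorm u <= 1 ->
    enorm (M *m u) <= Num.sqrt (\sum_i enorm (row i M)^T ^+ 2).
  move=> u1; rewrite ler_sqrt; last by apply: sumr_ge0 => i _; exact: sqr_ge0.
  apply: ler_sum => i _.
  have -> : (M *m u) i 0 = dotv (row i M)^T u.
    by rewrite mxE; apply: eq_bigr => j _; rewrite !mxE.
  have ru (w : 'cV[R]_l) : dotv w u <= enorm w.
    by rewrite (le_trans (dotv_le _ _))// ler_piMr ?enorm_ge0.
  rewrite -[leLHS]real_normK ?num_real// ler_sqr ?nnegrE ?normr_ge0 ?enorm_ge0//.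
  by rewrite ler_norml ru andbT lerNl -dotvNl -(enormN (_^T)) ru.
have hs : has_sup [set enorm (M *m u) | u in [set u : 'cV[R]_l | enorm u <= 1]].
  split.
    by exists (enorm (M *m 0)); exists 0 => //=; rewrite enorm0.
  exists (Num.sqrt (\sum_i enorm (row i M)^T ^+ 2)) => _ [u /= u1 <-].
  exact: nM.
have [->|v0] := eqVneq v 0.
  by rewrite mulmx0 !enorm0 mulr0.
have nv : 0 < enorm v by rewrite lt_neqAle eq_sym enorm_eq0 v0 enorm_ge0.
rewrite -ler_pdivrMr//; apply: ub_le_sup; first exact: hs.2.
exists ((enorm v)^-1 *: v) => /=.
  by rewrite enormZ ger0_norm ?invr_ge0 ?enorm_ge0// mulVf// gt_eqF.
by rewrite -scalemxAr enormZ ger0_norm ?invr_ge0 ?enorm_ge0// mulrC.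
Qed.

End EuclideanVectors.

(** * Block decomposition of vectors *)

Section BlockVectors.
Context {R : realType} {n : nat} {p_ : 'I_n -> nat}.
Local Notation X := ('cV[R]_(\sum_i p_ i)).

Lemma mulmx_blocks q (M : 'M[R]_(q, \sum_i p_ i)) (x : X) :
  M *m x = \sum_i submxrow M i *m submxcol x i.
Proof. by rewrite -mul_mxrow_mxcol submxrowK submxcolK. Qed.

Lemma dotv_blocks (u v : X) :
  dotv u v = \sum_i dotv (submxcol u i) (submxcol v i).
Proof.
rewrite dotvE mulmx_blocks summxE; apply: eq_bigr => i _.
by rewrite dotvE tr_submxcol.
Qed.

Lemma submxcolZ a (x : X) i : submxcol (a *: x) i = a *: submxcol x i.
Proof. by apply/matrixP => j k; rewrite !mxE. Qed.

Lemma submxcol_inj (x y : X) : (forall i, submxcol x i = submxcol y i) -> x = y.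
Proof. by move=> xy; rewrite -(submxcolK x) -(submxcolK y); apply/eq_mxcol. Qed.

(** The reflected equality carries [u] from the type of block i to that of block j. *)
Definition setblock (x : X) (i : 'I_n) (u : 'cV[R]_(p_ i)) : X :=
  \mxcol_j (match i =P j with
            | ReflectT e => ecast l 'cV[R]_(p_ l) e u
            | ReflectF _ => submxcol x j end).

Lemma setblock_eq x i u : submxcol (@setblock x i u) i = u.
Proof.
by rewrite mxcolK; case: eqP => // e; rewrite (eq_irrelevance e (erefl i)).
Qed.

Lemma setblock_neq x i u j : j != i -> submxcol (@setblock x i u) j = submxcol x j.
Proof.
by move=> ji; rewrite mxcolK; case: eqP => // e; rewrite e eqxx in ji.
Qed.

End BlockVectors.

(** * Derivatives, gradient inequality and descent along a line *)

Section Calculus.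
Context {R : realType}.

(** The difference quotient misses c by at most K |h|. This criterion treats squares and the
    piecewise function [psi] alike. *)
Lemma is_derive_quadratic (V : normedModType R) (f : V -> R) x v (c K : R) :
  (forall h, `|f (h *: v + x) - f x - c * h| <= K * h ^+ 2) ->
  is_derive x v f c.
Proof.
move=> fK.
have fc : (fun h => h^-1 *: (f (h *: v + x) - f x)) @ 0^' --> c.
  apply/cvgrPdist_le => e e0.
  have K0 : 0 < `|K| + 1 by rewrite ltr_wpDl.
  near=> h.
  have h0 : h != 0 by near: h; exact: nbhs_dnbhs_neq.
  have -> : c - h^-1 *: (f (h *: v + x) - f x) =
      - (h^-1 * (f (h *: v + x) - f x - c * h)).
    by rewrite mulrBr mulrCA mulVf// mulr1 opprB.
  rewrite normrN normrM normfV ler_pdivrMl ?normr_gt0//.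
  apply: le_trans (fK h) _; rewrite -[h ^+ 2]ger0_norm ?sqr_ge0// normrX.
  have he : `|h| <= e / (`|K| + 1).
    near: h; apply: dnbhs0_le; exact: divr_gt0.
  rewrite ler_pdivlMr// in he.
  have := normr_ge0 h; have := ler_norm K; nra.
by apply: DeriveDef; [apply/cvg_ex; exists c|exact/cvg_lim].
Unshelve. all: by end_near. Qed.

(** Completing the square in the first branch removes the case distinction. *)
Lemma psiE (beta u v : R) : 0 < beta ->
  psi beta u v = (pospart (beta * u + v) ^+ 2 - v ^+ 2) / (2 * beta).
Proof.
move=> b0; rewrite /psi /pospart; case: leP => _; field; lra.
Qed.

Lemma is_derive_psi (beta u v : R) : 0 < beta ->
  is_derive u 1 (fun u => psi beta u v) (pospart (beta * u + v)).
Proof.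
move=> b0; apply: (is_derive_quadratic (K := beta)) => h; rewrite [h *: 1]mulr1.
have dE : psi beta (h + u) v - psi beta u v - pospart (beta * u + v) * h =
    (pospart (beta * u + v + beta * h) ^+ 2 - pospart (beta * u + v) ^+ 2
     - 2 * pospart (beta * u + v) * (beta * h)) / (2 * beta).
  rewrite !psiE// (_ : beta * (h + u) + v = beta * u + v + beta * h); last by ring.
  by field; lra.
have b2 : 0 < 2 * beta by rewrite mulr_gt0.
rewrite {}dE normrM (gtr0_norm (x := (2 * beta)^-1)) ?invr_gt0// ler_pdivrMr//.
rewrite (_ : beta * h ^+ 2 * (2 * beta) = 2 * (beta * h) ^+ 2); last by ring.
move: (beta * u + v) (beta * h) => a d.
rewrite ler_norml /pospart; case: (leP 0 a) => a0; case: (leP 0 (a + d)) => ad;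
  apply/andP; split; nra.
Qed.

Lemma derive_grad k (f : 'cV[R]_k -> R) x v : differentiable f x ->
  'D_v f x = dotv (grad f x) v.
Proof.
move=> fx; rewrite deriveE//.
have -> : v = \sum_j v j 0 *: delta_mx j 0.
  apply/colP => i; rewrite summxE (bigD1 i)//= big1 ?addr0.
    by rewrite !mxE !eqxx mulr1.
  by move=> j ji; rewrite !mxE eq_sym (negbTE ji) mulr0.
rewrite linear_sum /= dotvC dotv_suml; apply: eq_bigr => j _.
rewrite linearZ /= dotvZl; congr (_ * _).
by rewrite dotvC dotv_delta mxE deriveE.
Qed.

Lemma convex_functionP k (f : 'cV[R]_k -> R) :
  convex_function [set: convex_lmodType 'cV[R]_k] f ->
  forall t x y, 0 <= t <= 1 ->
    f (t *: x + (1 - t) *: y) <= t * f x + (1 - t) * f y.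
Proof.
move=> cf t x y t01.
have := cf (Itv01 (proj1 (andP t01)) (proj2 (andP t01))) x y.
by rewrite !inE; exact.
Qed.

Lemma convex_gradient_le k (f : 'cV[R]_k -> R) x y :
  convex_function [set: convex_lmodType 'cV[R]_k] f -> differentiable f x ->
  f x + dotv (grad f x) (y - x) <= f y.
Proof.
move=> cf fx; rewrite -derive_grad// -lerBrDl.
have /cvg_dnbhs_at_right dv :
    (fun h => h^-1 *: (f (h *: (y - x) + x) - f x)) @ 0^' --> 'D_(y - x) f x.
  exact: diff_derivable.
rewrite -(cvg_lim (@Rhausdorff R) dv); apply: limr_le; first exact: cvgP dv.
near=> h.
have h0 : 0 < h by near: h; exact: nbhs_right_gt.
have h1 : h <= 1 by near: h; exact: nbhs_right_le.
rewrite ler_pdivrMl//.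
have := convex_functionP cf (t := h) y x; rewrite h1 ltW// => /(_ isT).
rewrite (_ : h *: y + (1 - h) *: x = h *: (y - x) + x); first lra.
by rewrite scalerBl scale1r scalerBr addrA addrAC.
Unshelve. all: by end_near. Qed.

Lemma is_derive_line (V : normedModType R) (f : V -> R) x v (t : R) :
  derivable f (t *: v + x) v ->
  is_derive t 1 (fun s => f (s *: v + x)) ('D_v f (t *: v + x)).
Proof.
have E : (fun h => h^-1 *: (f ((h *: 1 + t) *: v + x) - f (t *: v + x))) =
         (fun h => h^-1 *: (f (h *: v + (t *: v + x)) - f (t *: v + x))).
  by apply/funext => h; rewrite [h *: 1]mulr1 scalerDl addrA.
by move=> fv; apply: DeriveDef; rewrite /derivable /derive E.
Qed.

Lemma derive_comp_scalar (V : normedModType R) (phi : R -> R) (f : V -> R) x c :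
  differentiable f x -> is_derive (f x) 1 phi c ->
  differentiable (phi \o f) x /\ forall v, 'D_v (phi \o f) x = c * 'D_v f x.
Proof.
move=> fx pc.
have dphi : differentiable phi (f x) by apply/derivable1_diffP; exact: ex_derive.
split=> [|v]; first exact: differentiable_comp.
rewrite !deriveE//; last exact: differentiable_comp.
rewrite diff_comp//= deriv1E; last exact: ex_derive.
by rewrite derive1E derive_val mulrC.
Qed.

(** Mean value theorem for phi minus its quadratic model. Derivatives are compared with the one at 0
    only, since [block_lipschitz] compares gradients with the one at the current iterate only. *)
Lemma descent_line (phi dphi : R -> R) (l : R) :
  (forall t : R, is_derive t 1 phi (dphi t)) ->
  (forall t, 0 < t < 1 -> dphi t - dphi 0 <= l * t) ->
  phi 1 <= phi 0 + dphi 0 + l / 2.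
Proof.
move=> dp lp.
pose f t := phi t - (dphi 0 * t + l / 2 * t ^+ 2).
have df (t : R) : is_derive t 1 f (dphi t - (dphi 0 + l * t)).
  have dpt := dp t.
  apply: is_deriveB; apply: (is_derive_quadratic (K := `|l / 2|)) => h.
  rewrite [X in `|X|](_ : _ = l / 2 * h ^+ 2); last first.
    by rewrite [h *: 1]mulr1 /=; field.
  by rewrite normrM (ger0_norm (sqr_ge0 h)).
have [|c c01] := @MVT R f _ 0 1 ltr01 (fun t _ => df t).
  apply: continuous_subspaceT => t.
  apply: differentiable_continuous; apply/derivable1_diffP; exact: ex_derive.
rewrite in_itv/= in c01; have := lp c c01; rewrite /f !(mulr0, expr0n)/=.
rewrite expr1n; lra.
Qed.

End Calculus.

(** * Separable functions and proximal steps *)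

Section SeparableFunction.
Context {R : realType} {n : nat} {p_ : 'I_n -> nat} {q m : nat}.
Variable pb : problem R p_ q m.
Local Notation X := ('cV[R]_(\sum_i p_ i)).

(** Faithful on the domain only: [fine] sends infinite values to 0. *)
Definition hval (i : 'I_n) (u : 'cV[R]_(p_ i)) : R := fine (hblock pb u).
Definition hsum (x : X) : R := \sum_i hval (submxcol x i).

Context (h_proper : proper_fun (hfun pb)) (h_convex : convex_efun (hfun pb)).

(** Properness is assumed of the sum. A summand -oo makes the sum -oo even next to +oo, so a bad
    block inserted into any point would contradict it. *)
Lemma hblock_gtNy i (u : 'cV[R]_(p_ i)) : (-oo < hblock pb u)%E.
Proof.
have [[c _] hN] := h_proper; rewrite ltNge leeNy_eq; apply/negP => /eqP uN.
have := hN (setblock c u); rewrite /hfun ltNge leeNy_eq => /negP; apply.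
apply/eqP/esum_eqNyP; exists i; split=> //.
by rewrite setblock_eq.
Qed.

Lemma edom_blocks x : edom (hfun pb) x <->
  forall i, (hblock pb (submxcol x i) < +oo)%E.
Proof.
rewrite /edom/= /hfun; split=> [xd i|xd]; last exact: lte_sum_pinfty.
rewrite ltNge leye_eq; apply/negP => /eqP xi.
move: xd; rewrite ltNge leye_eq => /negP; apply; apply/eqP/esum_eqyP.
  by move=> j _; rewrite gt_eqF// hblock_gtNy.
by exists i; split.
Qed.

Lemma hvalK i (u : 'cV[R]_(p_ i)) : (hblock pb u < +oo)%E ->
  (hval u)%:E = hblock pb u.
Proof. by move=> uy; rewrite fineK// fin_numElt hblock_gtNy. Qed.

Lemma hfunE x : edom (hfun pb) x -> hfun pb x = (hsum x)%:E.
Proof.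
move=> /edom_blocks xd; rewrite /hfun /hsum -sumEFin.
by apply: eq_bigr => i _; rewrite hvalK.
Qed.

Lemma f0E x : edom (hfun pb) x -> f0 pb x = (gfun pb x + hsum x)%:E.
Proof. by move=> xd; rewrite /f0 hfunE. Qed.

Lemma hsum_convex x y t : edom (hfun pb) x -> edom (hfun pb) y -> 0 <= t <= 1 ->
  edom (hfun pb) (t *: x + (1 - t) *: y) /\
  hsum (t *: x + (1 - t) *: y) <= t * hsum x + (1 - t) * hsum y.
Proof.
move=> xd yd /andP[t0 t1].
have := h_convex x y t0 t1.
rewrite (hfunE xd) (hfunE yd) -!EFinM -EFinD => hc.
have cd : edom (hfun pb) (t *: x + (1 - t) *: y).
  exact: le_lt_trans hc (ltry _).
by split=> //; move: hc; rewrite hfunE// lee_fin.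
Qed.

Lemma hsum_setblock x i (u : 'cV[R]_(p_ i)) :
  hsum (setblock x u) = hsum x - hval (submxcol x i) + hval u.
Proof.
rewrite /hsum !(bigD1 i (P := xpredT))//= setblock_eq.
rewrite [X in _ = X - _ + _]addrC addrK addrC.
by congr (_ + _); apply: eq_bigr => j ji; rewrite setblock_neq.
Qed.

Lemma edom_setblock x i (u : 'cV[R]_(p_ i)) : edom (hfun pb) x ->
  (hblock pb u < +oo)%E -> edom (hfun pb) (setblock x u).
Proof.
move=> /edom_blocks xd uy; apply/edom_blocks => j.
by have [->|ji] := eqVneq j i; rewrite ?setblock_eq// setblock_neq.
Qed.

Lemma setblockD x i (u v : 'cV[R]_(p_ i)) t :
  t *: setblock x u + (1 - t) *: setblock x v = setblock x (t *: u + (1 - t) *: v).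
Proof.
apply: submxcol_inj => j; rewrite submxcolD !submxcolZ.
have [->|ji] := eqVneq j i; first by rewrite !setblock_eq.
by rewrite !setblock_neq// -scalerDl addrC subrK scale1r.
Qed.

(** Convexity of the sum passes to one block by freezing the other blocks at a point of the
    domain. *)
Lemma hval_convex i (u v : 'cV[R]_(p_ i)) t :
  (hblock pb u < +oo)%E -> (hblock pb v < +oo)%E -> 0 <= t <= 1 ->
  (hblock pb (t *: u + (1 - t) *: v) < +oo)%E /\
  hval (t *: u + (1 - t) *: v) <= t * hval u + (1 - t) * hval v.
Proof.
move=> uy vy t01; have [[c cd] _] := h_proper.
have [] := hsum_convex (edom_setblock cd uy) (edom_setblock cd vy) t01.
rewrite setblockD => /edom_blocks/(_ i); rewrite setblock_eq => wy.
by rewrite !hsum_setblock; split=> //; lra.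
Qed.

(** Quadratic growth of the proximal objective around its minimiser. Comparing u with the points of
    the segment towards v, dividing by t and letting t tend to 0 replaces subdifferential
    calculus. *)
Lemma prox_three_point i (c x u v : 'cV[R]_(p_ i)) (eta : R) :
  (hblock pb x < +oo)%E ->
  is_argmin (fun u => (hblock pb u
    + (dotv c u + eta / 2 * enorm (u - x) ^+ 2)%:E)%E) u ->
  (hblock pb v < +oo)%E ->
  (hblock pb u < +oo)%E /\
  hval u + dotv c u + eta / 2 * enorm (u - x) ^+ 2 + eta / 2 * enorm (v - u) ^+ 2
    <= hval v + dotv c v + eta / 2 * enorm (v - x) ^+ 2.
Proof.
move=> xy um vy.
have uy : (hblock pb u < +oo)%E.
  rewrite ltNge leye_eq; apply/negP => /eqP ueq.
  by have := um x; rewrite ueq -(hvalK xy) addye// leye_eq.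
split=> //.
have um' w : (hblock pb w < +oo)%E ->
    hval u + (dotv c u + eta / 2 * enorm (u - x) ^+ 2) <=
    hval w + (dotv c w + eta / 2 * enorm (w - x) ^+ 2).
  by move=> wy; have := um w; rewrite -(hvalK uy) -(hvalK wy) -!EFinD lee_fin.
pose a := hval v - hval u + dotv c (v - u) + eta * dotv (u - x) (v - u).
have at0 t : 0 < t <= 1 -> 0 <= a + t * (eta / 2 * enorm (v - u) ^+ 2).
  move=> /andP[t0 t1]; have t01 : 0 <= t <= 1 by rewrite ltW.
  have [wy wc] := hval_convex vy uy t01; have := um' _ wy.
  have -> : t *: v + (1 - t) *: u - x = (u - x) + t *: (v - u).
    by apply/colP => j; rewrite !mxE; ring.
  rewrite (enormD_sqr (u - x)) dotvZr enormZ exprMn real_normK ?num_real//.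
  rewrite (dotvDr _ _ c) !dotvZr => ineq.
  rewrite -(pmulr_rge0 _ t0) /a (dotvDr _ _ c) dotvNr.
  by move: (dotv (u - x) (v - u)) wc ineq => d; lra.
have a0 : 0 <= a.
  rewrite leNgt; apply/negP => a0.
  set K := eta / 2 * enorm (v - u) ^+ 2 in at0.
  (* For t = 1/M the second order term is at most - a / 2, too small to compensate a negative
     [a]. *)
  pose M := Num.max 1 (`|K| / - a * 2).
  have M1 : 1 <= M by rewrite le_max lexx.
  have M0 : 0 < M by lra.
  have /at0 : 0 < M^-1 <= 1 by rewrite invr_gt0 M0 invf_le1.
  rewrite -(pmulr_rge0 _ M0) mulrDr mulrA divff ?gt_eqF// mul1r.
  have : `|K| / - a * 2 <= M by rewrite le_max lexx orbT.
  rewrite -ler_pdivlMr// ler_pdivrMr ?oppr_gt0// => Ka.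
  by have := ler_norm K; have := normr_ge0 K; nra.
have -> : v - x = (u - x) + (v - u) by apply/colP => j; rewrite !mxE; ring.
by rewrite (enormD_sqr (u - x)); move: a0; rewrite /a (dotvDr _ _ c) dotvNr; lra.
Qed.

(** Two minimisers satisfy the three-point inequality against each other; the sum leaves eta |u -
    v|^2 <= 0. *)
Lemma prox_unique i (c x u v : 'cV[R]_(p_ i)) (eta : R) : 0 < eta ->
  (hblock pb x < +oo)%E ->
  let phi u := (hblock pb u
    + (dotv c u + eta / 2 * enorm (u - x) ^+ 2)%:E)%E in
  is_argmin phi u -> is_argmin phi v -> u = v.
Proof.
move=> eta0 xy phi um vm.
have [vy _] := prox_three_point xy vm xy.
have [uy uv] := prox_three_point xy um vy.
have [_ vu] := prox_three_point xy vm uy.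
apply/eqP; rewrite -subr_eq0 -enorm_eq0 -sqrf_eq0 eq_le sqr_ge0 andbT.
rewrite -(pmulr_rle0 _ eta0); move: uv vu.
by rewrite -(opprB u v) enormN; lra.
Qed.

End SeparableFunction.

(** * Augmented Lagrangian *)

Section PsiInequalities.
Context {R : realType}.
Variables (beta : R).
Context (beta_gt0 : 0 < beta).
Implicit Types u v : R.

(** Both the multiplier increment divided by rho_z and the derivative of [psi] in v. *)
Definition zincr u v : R := Num.max (- (v / beta)) u.

Lemma zincrE u v : zincr u v = (pospart (beta * u + v) - v) / beta.
Proof.
have bK w : beta * (w / beta) = w by rewrite mulrCA divff ?mulr1// gt_eqF.
suff <- : beta * zincr u v = pospart (beta * u + v) - v.
  by rewrite mulrC mulKf// gt_eqF.
rewrite /zincr /pospart.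
rewrite maxr_pMr ?ltW// mulrN bK.
by case: (leP 0 _) => h1; case: (leP (- v) _) => h2; lra.
Qed.

Lemma psi_zincr u v : psi beta u v = v * zincr u v + beta / 2 * zincr u v ^+ 2.
Proof. by rewrite psiE// zincrE; field; rewrite gt_eqF. Qed.

(** In u, [psi] is convex with derivative [beta u + v]_+, and its value at u = 0 is nonpositive. *)
Lemma psi_le_grad u v : psi beta u v <= pospart (beta * u + v) * u.
Proof.
rewrite psiE// -subr_ge0.
rewrite (_ : _ - _ = (2 * pospart (beta * u + v) * (beta * u)
  - (pospart (beta * u + v) ^+ 2 - v ^+ 2)) / (2 * beta)); last by field; rewrite gt_eqF.
rewrite divr_ge0 ?mulr_ge0 ?(ltW beta_gt0)//.
by move: (beta * u) => w; rewrite /pospart; case: (leP 0 (w + v)) => h; nra.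
Qed.

Lemma psi_concave u v v' :
  psi beta u v' <= psi beta u v + zincr u v * (v' - v).
Proof.
rewrite !psiE// zincrE -subr_ge0.
rewrite (_ : _ - _ =
  (pospart (beta * u + v) ^+ 2 + v' ^+ 2 - pospart (beta * u + v') ^+ 2 - v ^+ 2
  + 2 * (pospart (beta * u + v) - v) * (v' - v)) / (2 * beta)); last first.
  by field; rewrite gt_eqF.
rewrite divr_ge0 ?mulr_ge0 ?(ltW beta_gt0)//.
rewrite [leRHS](_ : _ = pospart (beta * u + v) ^+ 2 - pospart (beta * u + v') ^+ 2
  + 2 * pospart (beta * u + v) * ((beta * u + v') - (beta * u + v))
  + ((beta * u + v') - (beta * u + v)) ^+ 2); last by ring.
move: (beta * u + v) (beta * u + v') => a b; rewrite /pospart.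
case: (leP 0 a) => a0; case: (leP 0 b) => b0; rewrite ?expr0n/=.
- by rewrite le_eqVlt; apply/orP; left; apply/eqP; ring.
- by rewrite (_ : _ + _ = b ^+ 2) ?sqr_ge0//; ring.
- have : 0 <= b * - a by rewrite mulr_ge0// oppr_ge0 ltW.
  by have := sqr_ge0 a; nra.
- by have := sqr_ge0 (b - a); nra.
Qed.

(** With m the increment, the difference of squares contributes (v - mu) m + rho/2 m^2, so only mu u
    <= mu m remains, and u <= m. *)
Lemma psi_ge_multiplier u v mu rho : 0 <= mu -> 0 < rho ->
  mu * u + (2 * rho)^-1 * ((v + rho * zincr u v - mu) ^+ 2 - (v - mu) ^+ 2)
    + (beta - rho) / 2 * zincr u v ^+ 2 <= psi beta u v.
Proof.
move=> mu0 rho0; rewrite psi_zincr.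
have : u <= zincr u v by rewrite le_max lexx orbT.
move: (zincr u v) => m um.
rewrite (_ : (2 * rho)^-1 * _ = (v - mu) * m + rho / 2 * m ^+ 2).
  nra.
by field; rewrite gt_eqF.
Qed.

Lemma psi0 u : psi beta u 0 = beta / 2 * pospart u ^+ 2.
Proof.
rewrite psiE// addr0 expr0n subr0.
have -> : pospart (beta * u) = beta * pospart u.
  by rewrite /pospart maxr_pMr ?ltW// mulr0.
by field; rewrite gt_eqF.
Qed.

End PsiInequalities.

(** * Gradient and block descent of the augmented Lagrangian *)

Section AugmentedLagrangian.
Context {R : realType} {n : nat} {p_ : 'I_n -> nat} {q m : nat}.
Variables (pb : problem R p_ q m) (beta : R).
Local Notation X := ('cV[R]_(\sum_i p_ i)).
Local Notation g := (gfun pb).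
Local Notation f := (fcon pb).
Local Notation A := (Amat pb).
Context (beta_gt0 : 0 < beta) (pb_convex : convex_problem pb).

Let g_diff x : differentiable g x.
Proof. by have [[]] := pb_convex. Qed.

Let f_diff j x : differentiable (f j) x.
Proof. by have [_ /(_ j)[]] := pb_convex. Qed.

Lemma residD (x v : X) : resid pb (v + x) = resid pb x + A *m v.
Proof. by rewrite /resid mulmxDr -addrA addrC. Qed.

Lemma Gaug_derive z x : differentiable (Gaug pb beta z) x /\
  forall v, 'D_v (Gaug pb beta z) x = dotv (grad g x) v
    + \sum_j pospart (beta * f j x + z j 0) * dotv (grad (f j) x) v.
Proof.
pose F j := (fun u => psi beta u (z j 0)) \o f j.
have FD j := derive_comp_scalar (f_diff j x) (is_derive_psi (f j x) (z j 0) beta_gt0).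
have GE : Gaug pb beta z = g + \sum_j F j.
  by apply/funext => x'; rewrite /Gaug /Psi/= fctE fct_sumE.
have sF : differentiable (\sum_j F j) x.
  by apply: differentiable_sum => j; have [] := FD j.
rewrite GE; split=> [|v]; first exact: differentiableD.
rewrite deriveD ?derive_grad//; [|exact: diff_derivable|exact: diff_derivable].
rewrite -!derive_grad//; congr (_ + _); rewrite derive_sum => [|j].
  by apply: eq_bigr => j _; have [_ ->] := FD j; rewrite derive_grad.
by apply: diff_derivable; have [] := FD j.
Qed.

Lemma resid_quadratic y x v : is_derive x v
  (fun x => dotv y (resid pb x) + beta / 2 * enorm (resid pb x) ^+ 2)
  (dotv (A^T *m (y + beta *: resid pb x)) v).
Proof.
apply: (is_derive_quadratic (K := beta / 2 * enorm (A *m v) ^+ 2)) => h.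
rewrite residD -scalemxAr dotv_trmx dotvDl dotvZl enormD_sqr dotvDr !dotvZr.
rewrite enormZ exprMn real_normK ?num_real//.
rewrite [X in `|X|](_ : _ = beta / 2 * enorm (A *m v) ^+ 2 * h ^+ 2); last first.
  by field.
rewrite ger0_norm// mulr_ge0 ?sqr_ge0// mulr_ge0 ?sqr_ge0//.
by rewrite divr_ge0// ltW.
Qed.

Lemma grad_Faug x y z : grad (fun x => Faug pb beta x y z) x =
  grad (Gaug pb beta z) x + A^T *m (y + beta *: resid pb x).
Proof.
apply/colP => j; rewrite mxE [RHS]mxE [X in _ = X + _]mxE.
have [Gd _] := Gaug_derive z x.
have qd := resid_quadratic y x (delta_mx j 0).
have -> : (fun x => Faug pb beta x y z) = Gaug pb beta z +
    (fun x => dotv y (resid pb x) + beta / 2 * enorm (resid pb x) ^+ 2).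
  by apply/funext => u; rewrite /Faug /Gaug fctE; ring.
rewrite deriveD; [|exact: diff_derivable|exact: ex_derive].
by rewrite derive_val dotv_delta.
Qed.

(** The part [Gaug] has curvature at most lb along block i. The remaining terms are exactly
    quadratic, with curvature at most beta |A_i|^2. The two add up to at most eta. *)
Lemma block_descent x x' y z i l lb eta :
  edom (hfun pb) x -> edom (hfun pb) x' ->
  (forall j, j != i -> submxcol x' j = submxcol x j) ->
  block_lipschitz pb beta (Iterate x y z) i l -> l <= lb ->
  lb + beta * spectral_norm (submxrow A i) ^+ 2 <= eta ->
  Faug pb beta x' y z <= Faug pb beta x y z
    + dotv (submxcol (grad (fun x => Faug pb beta x y z) x) i)
           (submxcol x' i - submxcol x i)
    + eta / 2 * enorm (submxcol x' i - submxcol x i) ^+ 2.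
Proof.
move=> xd x'd x'x lip llb etab.
pose d := x' - x; pose di := submxcol x' i - submxcol x i.
have dE : submxcol d i = di by rewrite /d submxcolB.
have d0 j : j != i -> submxcol d j = 0.
  by move=> ji; rewrite /d submxcolB x'x// subrr.
have dotd u : dotv u d = dotv (submxcol u i) di.
  rewrite dotv_blocks (bigD1 i)//= big1 ?addr0 ?dE// => j ji.
  by rewrite d0// dotvC dot0v.
have Ad : A *m d = submxrow A i *m di.
  rewrite mulmx_blocks (bigD1 i)//= big1 ?addr0 ?dE// => j ji.
  by rewrite d0// mulmx0.
have GD : Gaug pb beta z x' <= Gaug pb beta z x
    + dotv (submxcol (grad (Gaug pb beta z) x) i) di + lb / 2 * enorm di ^+ 2.
  pose phi t := Gaug pb beta z (t *: d + x).
  pose dphi t := 'D_d (Gaug pb beta z) (t *: d + x).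
  have Gd u : differentiable (Gaug pb beta z) u by have [] := Gaug_derive z u.
  have := @descent_line R phi dphi (lb * enorm di ^+ 2).
  rewrite /phi /dphi scale1r scale0r subrK add0r derive_grad// dotd.
  rewrite (mulrAC lb); apply=> t.
    by apply: is_derive_line; exact: diff_derivable.
  move=> /andP[t0 t1]; rewrite derive_grad// dotd -dotvNl -dotvDl.
  rewrite (le_trans (dotv_le _ _))//.
  (* The Lipschitz bound is available on the domain of h only; convexity keeps the segment
     inside. *)
  have td : edom (hfun pb) (t *: d + x).
    have -> : t *: d + x = t *: x' + (1 - t) *: x.
      by apply/colP => j; rewrite !mxE; ring.
    have [_ _ [hp _ hc]] := pb_convex.
    have t01 : 0 <= t <= 1 by rewrite !ltW.
    by have [] := hsum_convex hp hc x'd xd t01.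
  have tdx j : j != i -> submxcol (t *: d + x) j = submxcol x j.
    by move=> ji; rewrite submxcolD submxcolZ d0// scaler0 add0r.
  have lip' := lip (t *: d + x) td tdx.
  have tdi : submxcol (t *: d + x) i - submxcol x i = t *: di.
    by rewrite submxcolD submxcolZ dE addrK.
  rewrite tdi enormZ (ger0_norm (ltW t0)) in lip'.
  apply: le_trans (ler_wpM2r (enorm_ge0 di) lip') _.
  rewrite (_ : lb * _ * t = lb * (t * enorm di) * enorm di); last by ring.
  by rewrite ler_wpM2r ?enorm_ge0// ler_wpM2r// mulr_ge0 ?enorm_ge0// ltW.
rewrite grad_Faug submxcolD dotvDl -/di -(dotd (_ *m _)) dotv_trmx.
have x'E : x' = d + x by rewrite subrK.
have -> : Faug pb beta x' y z = Gaug pb beta z x' +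
    (dotv y (resid pb x) + beta / 2 * enorm (resid pb x) ^+ 2
    + dotv (y + beta *: resid pb x) (A *m d) + beta / 2 * enorm (A *m d) ^+ 2).
  rewrite /Faug {2 3}x'E residD enormD_sqr dotvDr dotvDl dotvZl /Gaug.
  by field.
have Adb : beta * enorm (A *m d) ^+ 2 <=
    beta * (spectral_norm (submxrow A i) ^+ 2 * enorm di ^+ 2).
  rewrite ler_pM2l// -exprMn ler_sqr ?nnegrE ?enorm_ge0//.
    by rewrite Ad enorm_mulmx_le.
  by rewrite (le_trans (enorm_ge0 _) (enorm_mulmx_le _ _)).
have {}etab := ler_wpM2r (sqr_ge0 (enorm di)) etab.
by move: GD Adb etab; rewrite /Faug /Gaug; lra.
Qed.

End AugmentedLagrangian.

(** * One step of BLALM *)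

Section Descent.
Context {R : realType} {n : nat} {p_ : 'I_n -> nat} {q m : nat}.
Variables (pb : problem R p_ q m) (beta rhoy rhoz : R) (eta : 'I_n -> R).
Variables (xs : 'cV[R]_(\sum_i p_ i)).
Local Notation X := ('cV[R]_(\sum_i p_ i)).
Local Notation g := (gfun pb).
Local Notation f := (fcon pb).
Local Notation A := (Amat pb).
Context (n_gt0 : (0 < n)%N) (beta_gt0 : 0 < beta) (pb_convex : convex_problem pb).

Let h_proper : proper_fun (hfun pb). Proof. by have [_ _ []] := pb_convex. Qed.
Let h_convex : convex_efun (hfun pb). Proof. by have [_ _ []] := pb_convex. Qed.

Definition merit x y z : R :=
  Faug pb beta x y z + hsum pb x - (g xs + hsum pb xs).

Definition wdist (x : X) : R :=
  2^-1 * \sum_i eta i * enorm (submxcol x i - submxcol xs i) ^+ 2.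

(* The amount by which one step fails to be a supermartingale decrease. *)
Definition gain (w w' : iterate R p_ q m) : R :=
  merit (xpart w') (ypart w) (zpart w)
  - (1 - n%:R^-1) * merit (xpart w) (ypart w) (zpart w)
  + beta / (2 * n%:R) * enorm (resid pb (xpart w)) ^+ 2
  + wdist (xpart w') - wdist (xpart w).

Lemma blalm_step_edom w i w' : edom (hfun pb) (xpart w) ->
  blalm_step pb beta rhoy rhoz eta w i w' -> edom (hfun pb) (xpart w').
Proof.
case: w w' => [x y z] [x' y' z']/= xd [um x'x _ _].
have /(edom_blocks h_proper) xb := xd.
have [uy _] := prox_three_point h_proper h_convex (xb i) um (xb i).
apply/(edom_blocks h_proper) => j.
by have [->//|ji] := eqVneq j i; rewrite x'x.
Qed.

Lemma blalm_step_unique w i w1 w2 : (forall i, 0 < eta i) ->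
  edom (hfun pb) (xpart w) ->
  blalm_step pb beta rhoy rhoz eta w i w1 ->
  blalm_step pb beta rhoy rhoz eta w i w2 -> w1 = w2.
Proof.
case: w w1 w2 => [x y z] [x1 y1 z1] [x2 y2 z2]/= eta0 xd.
move=> [u1 x1x -> z1E] [u2 x2x -> z2E].
have /(edom_blocks h_proper) xb := xd.
have x12 : x1 = x2.
  apply: submxcol_inj => j.
  have [->|ji] := eqVneq j i; last by rewrite x1x ?x2x.
  exact: (prox_unique h_proper h_convex (eta0 i) (xb i) u1 u2).
by rewrite x12; congr Iterate; apply/colP => j; rewrite z1E z2E x12.
Qed.

(** Block descent plus the three-point inequality at block i of [xs]. The bracket on the right
    involves the old point only, so summing it over i restores the full inner product and the
    difference of h. *)
Lemma blalm_step_descent x y z i x' y' z' l lb :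
  edom (hfun pb) x -> edom (hfun pb) xs ->
  block_lipschitz pb beta (Iterate x y z) i l -> l <= lb ->
  lb + beta * spectral_norm (submxrow A i) ^+ 2 <= eta i ->
  blalm_step pb beta rhoy rhoz eta (Iterate x y z) i (Iterate x' y' z') ->
  merit x' y z + wdist x' <= merit x y z + wdist x
   + (dotv (submxcol (grad (fun v => Faug pb beta v y z) x) i)
        (submxcol (xs - x) i)
      + hval pb (submxcol xs i) - hval pb (submxcol x i)).
Proof.
move=> xd xsd lip llb etab st.
have x'd : edom (hfun pb) x' by exact: (blalm_step_edom _ st).
have [um x'x _ _] := st.
have /(edom_blocks h_proper) xb := xd.
have /(edom_blocks h_proper) xsb := xsd.
have [_ tp] := prox_three_point h_proper h_convex (xb i) um (xsb i).
have := block_descent beta_gt0 pb_convex xd x'd x'x lip llb etab.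
have hx' : hsum pb x' - hsum pb x =
    hval pb (submxcol x' i) - hval pb (submxcol x i).
  rewrite /hsum !(bigD1 i (P := xpredT))//=.
  rewrite (eq_bigr (fun j => hval pb (submxcol x j))) => [|j ji].
    by ring.
  by rewrite x'x.
have dx' : wdist x' - wdist x = eta i / 2 * enorm (submxcol x' i - submxcol xs i) ^+ 2
    - eta i / 2 * enorm (submxcol x i - submxcol xs i) ^+ 2.
  rewrite /wdist !(bigD1 i (P := xpredT))//=.
  rewrite (eq_bigr (fun j => eta j * enorm (submxcol x j - submxcol xs j) ^+ 2)).
    by field.
  by move=> j ji; rewrite x'x.
move: tp; rewrite /merit submxcolB !dotvDr !dotvNr.
rewrite -(enormN (_ xs i - _ x i)) -(enormN (_ xs i - _ x' i)) !opprB.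
by move: hx' dx'; lra.
Qed.

(** Gradient inequalities for g and the f_j, with [psi_le_grad] for the penalty. The linear term
    gives - beta |r|^2 while [Faug] contains only beta/2 |r|^2, whence the surplus. *)
Lemma grad_Faug_le x y z : A *m xs = bvec pb -> (forall j, f j xs <= 0) ->
  dotv (grad (fun v => Faug pb beta v y z) x) (xs - x) + Faug pb beta x y z
    + beta / 2 * enorm (resid pb x) ^+ 2 <= g xs.
Proof.
move=> Axs fxs; rewrite grad_Faug// dotvDl.
have [[gc gd _] fcs _] := pb_convex.
have [Gd GD] := Gaug_derive beta_gt0 pb_convex z x.
rewrite -derive_grad// GD dotv_trmx mulmxBr Axs.
have -> : bvec pb - A *m x = - resid pb x by rewrite opprB.
rewrite dotvNr dotvDl dotvZl -enorm_sqr /Faug.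
have := convex_gradient_le xs gc (gd x).
have : \sum_j pospart (beta * f j x + z j 0) * dotv (grad (f j) x) (xs - x)
    <= - Psi pb beta x z.
  rewrite /Psi -sumrN; apply: ler_sum => j _.
  have [fc fd _] := fcs j.
  have := convex_gradient_le xs fc (fd x); have := fxs j.
  have := psi_le_grad beta_gt0 (f j x) (z j 0).
  have : 0 <= pospart (beta * f j x + z j 0) by rewrite /pospart le_max lexx.
  by nra.
by lra.
Qed.

(** The sum is n times the conditional mean of the gain given [w], with [w' i] the outcome of
    drawing block i. *)
Lemma gain_sum_le0 w (w' : 'I_n -> iterate R p_ q m) (ell lb : 'I_n -> R) :
  edom (hfun pb) (xpart w) -> edom (hfun pb) xs ->
  A *m xs = bvec pb -> (forall j, f j xs <= 0) ->
  (forall i, block_lipschitz pb beta w i (ell i)) ->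
  (forall i, ell i <= lb i) ->
  (forall i, lb i + beta * spectral_norm (submxrow A i) ^+ 2 <= eta i) ->
  (forall i, blalm_step pb beta rhoy rhoz eta w i (w' i)) ->
  \sum_i gain w (w' i) <= 0.
Proof.
case: w => [x y z]/= xd xsd Axs fxs lip llb etab st.
have n0 : n%:R != 0 :> R by rewrite pnatr_eq0 -lt0n.
pose G := grad (fun v => Faug pb beta v y z) x.
have : \sum_i gain (Iterate x y z) (w' i) <=
    \sum_i ((dotv (submxcol G i) (submxcol (xs - x) i)
      + hval pb (submxcol xs i) - hval pb (submxcol x i))
      + n%:R^-1 * (merit x y z + beta / 2 * enorm (resid pb x) ^+ 2)).
  apply: ler_sum => i _; move: (st i); case: (w' i) => [x' y' z'] sti.
  have := blalm_step_descent xd xsd (lip i) (llb i) (etab i) sti.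
  rewrite /gain/= -/G (_ : beta / (2 * n%:R) = n%:R^-1 * (beta / 2)); last by field.
  by lra.
move=> /le_trans; apply; rewrite big_split/= sumr_const card_ord.
rewrite -[X in _ + X]mulr_natl mulVKf// !big_split/= -dotv_blocks sumrN.
have := grad_Faug_le x y z Axs fxs.
by rewrite -/G /merit /hsum; lra.
Qed.

End Descent.

(** * Trajectories *)

Section WeightedJensen.
Context {R : realType} {V : lmodType R}.
Variables (D : set V) (phi : V -> R).

(** Induction on k: the new average is a convex combination of the old one, with weight W / (W + a),
    and of [x k]. Membership in D is carried along because convexity is known on D only. *)
Lemma jensen_lazy_average (a : R) (u : V) (x : nat -> V) : 0 <= a ->
  (forall x y t, D x -> D y -> 0 <= t <= 1 ->
    D (t *: x + (1 - t) *: y) /\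
    phi (t *: x + (1 - t) *: y) <= t * phi x + (1 - t) * phi y) ->
  D u -> (forall t, D (x t)) -> forall k,
  D ((1 + k%:R * a)^-1 *: (u + a *: \sum_(t < k) x t)) /\
  (1 + k%:R * a) * phi ((1 + k%:R * a)^-1 *: (u + a *: \sum_(t < k) x t))
    <= phi u + a * \sum_(t < k) phi (x t).
Proof.
move=> a0 cv Du Dx; elim=> [|k [IHD IHphi]].
  by rewrite !big_ord0 mul0r addr0 invr1 scaler0 mulr0 !addr0 scale1r mul1r.
set W := 1 + k%:R * a in IHD IHphi *; set v := W^-1 *: _ in IHD IHphi.
have W0 : 0 < W by rewrite ltr_wpDr// mulr_ge0.
have W'E : 1 + k.+1%:R * a = W + a by rewrite /W -natr1; ring.
have W'0 : 0 < W + a by rewrite ltr_wpDr.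
have t01 : 0 <= W / (W + a) <= 1.
  by rewrite divr_ge0 ?(ltW W0) ?(ltW W'0)//= ler_pdivrMr// mul1r lerDl.
have tE : 1 - W / (W + a) = a / (W + a) by field; rewrite gt_eqF.
have vE : (W + a)^-1 *: (u + a *: \sum_(t < k.+1) x t)
    = W / (W + a) *: v + (1 - W / (W + a)) *: x k.
  rewrite tE big_ord_recr/= [a *: (_ + _)]scalerDr addrA scalerDr /v !scalerA.
  rewrite (_ : W / (W + a) / W = (W + a)^-1); last by field; rewrite !gt_eqF.
  by rewrite (mulrC a).
rewrite W'E vE; have [D' phi'] := cv _ _ _ IHD (Dx k) t01; split=> //.
rewrite -(ler_pM2l W'0) in phi'; apply: le_trans phi' _.
rewrite tE big_ord_recr/= [leLHS](_ : _ = W * phi v + a * phi (x k)); last first.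
  by field; rewrite gt_eqF.
by rewrite mulrDr addrA lerD2r.
Qed.

End WeightedJensen.

(** * Lagrangian bounds along a single trajectory *)

Section Pathwise.
Context {R : realType} {n : nat} {p_ : 'I_n -> nat} {q m : nat}.
Variables (pb : problem R p_ q m) (beta rhoy rhoz : R) (eta : 'I_n -> R).
Variables (xs : 'cV[R]_(\sum_i p_ i)).
Local Notation X := ('cV[R]_(\sum_i p_ i)).
Local Notation g := (gfun pb).
Local Notation f := (fcon pb).
Local Notation A := (Amat pb).
Local Notation Fs := (g xs + hsum pb xs).
Context (n_gt0 : (0 < n)%N) (beta_gt0 : 0 < beta) (pb_convex : convex_problem pb).
Context (eta_gt0 : forall i, 0 < eta i).
Context (rhoy_gt0 : 0 < rhoy) (rhoy_le : rhoy <= beta / n%:R).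
Context (rhoz_gt0 : 0 < rhoz) (rhoz_le : rhoz <= beta / (2 * n%:R)).

Local Notation merit := (merit pb beta xs).
Local Notation gain := (gain pb beta eta xs).
Local Notation wdist := (wdist eta xs).

Implicit Types (x : X) (y : 'cV[R]_q) (z : 'cV[R]_m) (lam : 'cV[R]_q) (mu : 'I_m -> R).

Definition lagr (lam : 'cV[R]_q) (mu : 'I_m -> R) (x : X) : R :=
  g x + hsum pb x - Fs + dotv lam (resid pb x) + \sum_j mu j * f j x.

Definition dual_dist (lam : 'cV[R]_q) (mu : 'I_m -> R) y (z : 'cV[R]_m) : R :=
  (2 * rhoy)^-1 * enorm (y - lam) ^+ 2
  + (2 * rhoz)^-1 * \sum_j (z j 0 - mu j) ^+ 2.

(** Plays for the inequality constraints the role of the squared residual. *)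
Definition zstep (x : X) (z : 'cV[R]_m) : R :=
  \sum_j zincr beta (f j x) (z j 0) ^+ 2.

Lemma lagr_convex lam mu : (forall j, 0 <= mu j) -> forall (x y : X) t,
  edom (hfun pb) x -> edom (hfun pb) y -> 0 <= t <= 1 ->
  edom (hfun pb) (t *: x + (1 - t) *: y) /\
  lagr lam mu (t *: x + (1 - t) *: y) <= t * lagr lam mu x + (1 - t) * lagr lam mu y.
Proof.
move=> mu0 x y t xd yd t01.
have [[gc _ _] fcs [hp _ hc]] := pb_convex.
have [td hle] := hsum_convex hp hc xd yd t01; split=> //.
have gle := convex_functionP gc x y t01.
have fle : \sum_j mu j * f j (t *: x + (1 - t) *: y) <=
    t * \sum_j mu j * f j x + (1 - t) * \sum_j mu j * f j y.
  rewrite !mulr_sumr -big_split/=; apply: ler_sum => j _.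
  have [fc _ _] := fcs j.
  have := ler_wpM2l (mu0 j) (convex_functionP fc x y t01); lra.
have rE : resid pb (t *: x + (1 - t) *: y) = t *: resid pb x + (1 - t) *: resid pb y.
  rewrite /resid mulmxDr -!scalemxAr.
  by apply/colP => j; rewrite !mxE; ring.
by rewrite /lagr rE dotvDr !dotvZr; lra.
Qed.

(** By stationarity and convexity [xs] minimises the Lagrangian at the KKT multipliers; by
    complementarity the minimum is 0. *)
Lemma lagr_KKT_ge0 ys zs x : KKT pb (Iterate xs ys zs) -> edom (hfun pb) xs ->
  edom (hfun pb) x -> 0 <= lagr ys (fun j => zs j 0) x.
Proof.
move=> [[v vsub st] Axs cs] xsd xd.
have [[gc gd _] fcs [hp _ hc]] := pb_convex.
have hle : hsum pb xs + dotv v (x - xs) <= hsum pb x.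
  by have := vsub x; rewrite !hfunE// -EFinD lee_fin.
have gle := convex_gradient_le x gc (gd xs).
have fle : \sum_j dotv (zs j 0 *: grad (f j) xs) (x - xs) <= \sum_j zs j 0 * f j x.
  apply: ler_sum => j _; have [fc fd _] := fcs j; have [z0 _ zf] := cs j.
  have := ler_wpM2l z0 (convex_gradient_le x fc (fd xs)).
  by rewrite dotvZl mulrDr zf add0r.
have : dotv (grad g xs + v + A^T *m ys + \sum_j zs j 0 *: grad (f j) xs) (x - xs) = 0.
  by rewrite st dot0v.
rewrite !dotvDl dotv_suml dotv_trmx mulmxBr Axs -/(resid pb x) /lagr.
by lra.
Qed.

(** Expanding |y + rho_y r - lam|^2 exchanges y for lam in the linear term exactly;
    [psi_ge_multiplier] does the same for z, with an inequality. *)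
Lemma merit_ge_lagr lam mu x y z : (forall j, 0 <= mu j) ->
  lagr lam mu x
  + (dual_dist lam mu (y + rhoy *: resid pb x)
       (\col_j (z j 0 + rhoz * zincr beta (f j x) (z j 0))) - dual_dist lam mu y z)
  + (beta - rhoy) / 2 * enorm (resid pb x) ^+ 2 + (beta - rhoz) / 2 * zstep x z
  <= merit x y z.
Proof.
move=> mu0; rewrite /lagr /dual_dist /merit /Faug.
have yE : enorm (y + rhoy *: resid pb x - lam) ^+ 2 = enorm (y - lam) ^+ 2
    + 2 * rhoy * (dotv y (resid pb x) - dotv lam (resid pb x))
    + rhoy ^+ 2 * enorm (resid pb x) ^+ 2.
  rewrite (addrAC y) (enormD_sqr (y - lam)) dotvZr dotvDl dotvNl enormZ exprMn.
  by rewrite real_normK ?num_real//; ring.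
have zle : \sum_j mu j * f j x + (2 * rhoz)^-1 *
    (\sum_j ((\col_j (z j 0 + rhoz * zincr beta (f j x) (z j 0))) j 0 - mu j) ^+ 2
     - \sum_j (z j 0 - mu j) ^+ 2) + (beta - rhoz) / 2 * zstep x z <= Psi pb beta x z.
  rewrite /zstep -sumrB !mulr_sumr -!big_split/=; apply: ler_sum => j _.
  by rewrite mxE; exact: psi_ge_multiplier.
have {}yE : (2 * rhoy)^-1 * enorm (y + rhoy *: resid pb x - lam) ^+ 2 =
   (2 * rhoy)^-1 * enorm (y - lam) ^+ 2
    + (dotv y (resid pb x) - dotv lam (resid pb x))
    + rhoy / 2 * enorm (resid pb x) ^+ 2.
  by rewrite yE; field; rewrite gt_eqF.
by move: yE zle; lra.
Qed.

(** The merit is affine in y and concave in z, so the tangent at the old multipliers bounds it. *)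
Lemma merit_dual_step x y z :
  merit x (y + rhoy *: resid pb x)
    (\col_j (z j 0 + rhoz * zincr beta (f j x) (z j 0)))
  <= merit x y z + rhoy * enorm (resid pb x) ^+ 2 + rhoz * zstep x z.
Proof.
rewrite /merit /Faug dotvDl dotvZl -enorm_sqr.
suff : Psi pb beta x (\col_j (z j 0 + rhoz * zincr beta (f j x) (z j 0)))
    <= Psi pb beta x z + rhoz * zstep x z by lra.
rewrite /Psi /zstep mulr_sumr -big_split/=; apply: ler_sum => j _.
rewrite mxE; apply: le_trans (psi_concave beta_gt0 _ (z j 0) _) _.
by rewrite lerD2l addrAC subrr add0r mulrCA -expr2.
Qed.

(* With a = 1/n, d = y - lam and r the residual, the y-part is at least       *)
(* |a d + rhoy r|^2 / (2 a rhoy), since n rhoy <= beta; likewise for z.       *)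
Lemma dual_dist_step_ge0 lam mu x y z :
  0 <= dual_dist lam mu (y + rhoy *: resid pb x)
       (\col_j (z j 0 + rhoz * zincr beta (f j x) (z j 0)))
    - (1 - n%:R^-1) * dual_dist lam mu y z
  + (beta - rhoy) / 2 * enorm (resid pb x) ^+ 2 + (beta - rhoz) / 2 * zstep x z.
Proof.
have n0 : 0 < n%:R :> R by rewrite ltr0n.
have young (rho s d r : R) : 0 < rho -> rho * n%:R <= beta ->
    (* s, d, r stand for |y - lam|^2, <y - lam, resid>, |resid|^2 *)
    0 <= n%:R^-1 ^+ 2 * s + 2 * n%:R^-1 * rho * d + rho ^+ 2 * r -> 0 <= r ->
    0 <= (2 * rho)^-1 * (s + 2 * rho * d + rho ^+ 2 * r)
      - (1 - n%:R^-1) * ((2 * rho)^-1 * s) + (beta - rho) / 2 * r.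
  move=> rho0 rhob sq r0.
  rewrite [leRHS](_ : _ = n%:R / (2 * rho) *
      (n%:R^-1 ^+ 2 * s + 2 * n%:R^-1 * rho * d + rho ^+ 2 * r)
      + (beta - rho * n%:R) / 2 * r); last by field; rewrite !gt_eqF.
  have c0 : 0 <= n%:R / (2 * rho) by rewrite divr_ge0 ?mulr_ge0 ?(ltW rho0).
  have b0 : 0 <= (beta - rho * n%:R) / 2 by rewrite divr_ge0// subr_ge0.
  by rewrite addr_ge0// mulr_ge0.
have rhoyb : rhoy * n%:R <= beta by rewrite -ler_pdivlMr.
have rhozb : rhoz * n%:R <= beta.
  have := mulr_ge0 (ltW rhoz_gt0) (ltW n0).
  by move: rhoz_le; rewrite ler_pdivlMr ?mulr_gt0//; lra.
have y0 := young _ (enorm (y - lam) ^+ 2) (dotv (y - lam) (resid pb x))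
  (enorm (resid pb x) ^+ 2) rhoy_gt0 rhoyb.
have {}y0 : 0 <= (2 * rhoy)^-1 * enorm (y + rhoy *: resid pb x - lam) ^+ 2
    - (1 - n%:R^-1) * ((2 * rhoy)^-1 * enorm (y - lam) ^+ 2)
    + (beta - rhoy) / 2 * enorm (resid pb x) ^+ 2.
  rewrite (addrAC y) (enormD_sqr (y - lam)) dotvZr enormZ exprMn.
  rewrite real_normK ?num_real// mulrA.
  apply: y0; last exact: sqr_ge0.
  have := sqr_ge0 (enorm (n%:R^-1 *: (y - lam) + rhoy *: resid pb x)).
  rewrite (enormD_sqr (_ *: _)) dotvZl dotvZr !enormZ !exprMn !real_normK ?num_real//.
  by rewrite !mulrA.
have z0 : 0 <= (2 * rhoz)^-1 *
     \sum_j ((\col_j (z j 0 + rhoz * zincr beta (f j x) (z j 0))) j 0 - mu j) ^+ 2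
    - (1 - n%:R^-1) * ((2 * rhoz)^-1 * \sum_j (z j 0 - mu j) ^+ 2)
    + (beta - rhoz) / 2 * zstep x z.
  rewrite /zstep !mulr_sumr -sumrB -big_split/=; apply: sumr_ge0 => j _.
  rewrite mxE; set d := z j 0 - mu j; set r := zincr _ _ _.
  rewrite (_ : (_ + rhoz * r - mu j) ^+ 2 =
    d ^+ 2 + 2 * rhoz * (d * r) + rhoz ^+ 2 * r ^+ 2); last by rewrite /d; ring.
  apply: young => //; last exact: sqr_ge0.
  by have := sqr_ge0 (n%:R^-1 * d + rhoz * r); rewrite sqrrD !exprMn; lra.
by move: y0 z0; rewrite /dual_dist; lra.
Qed.

Section Trajectory.
Variables (w : nat -> iterate R p_ q m) (I : nat -> 'I_n) (x0 : X).
Context (w0 : w 0%N = Iterate x0 0 0).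
Context (w_step : forall k, blalm_step pb beta rhoy rhoz eta (w k) (I k) (w k.+1)).
Context (x0_dom : edom (hfun pb) x0).

Lemma traj_edom k : edom (hfun pb) (xpart (w k)).
Proof.
elim: k => [|k IH]; first by rewrite w0.
exact (blalm_step_edom pb_convex IH (w_step k)).
Qed.

Lemma traj_y k : ypart (w k.+1) = ypart (w k) + rhoy *: resid pb (xpart (w k.+1)).
Proof.
by move: (w_step k); case: (w k) (w k.+1) => [x y z] [x' y' z'] [].
Qed.

Lemma traj_z k : zpart (w k.+1) = \col_j (zpart (w k) j 0
  + rhoz * zincr beta (f j (xpart (w k.+1))) (zpart (w k) j 0)).
Proof.
move: (w_step k); case: (w k) (w k.+1) => [x y z] [x' y' z'] [_ _ _ zE].
by apply/colP => j; rewrite mxE zE.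
Qed.

Lemma gain_sum_ge lam mu k : (forall j, 0 <= mu j) ->
  lagr lam mu (xpart (w k.+1))
  + n%:R^-1 * \sum_(t < k) lagr lam mu (xpart (w t.+1))
  - n%:R^-1 * dual_dist lam mu 0 0
  <= (1 - n%:R^-1) * merit x0 0 0 + wdist x0
     + \sum_(t < k.+1) gain (w t) (w t.+1).
Proof.
move=> mu0.
pose a : R := n%:R^-1; rewrite -/a.
have a0 : 0 < a by rewrite invr_gt0 ltr0n.
pose E t := dual_dist lam mu (ypart (w t)) (zpart (w t)).
pose rs t := enorm (resid pb (xpart (w t))) ^+ 2.
have rs0 t : 0 <= rs t by exact: sqr_ge0.
pose ms t := zstep (xpart (w t.+1)) (zpart (w t)).
have ms0 t : 0 <= ms t by apply: sumr_ge0 => j _; exact: sqr_ge0.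
pose Q t := merit (xpart (w t.+1)) (ypart (w t)) (zpart (w t)).
have QL t : lagr lam mu (xpart (w t.+1)) + (E t.+1 - E t)
    + (beta - rhoy) / 2 * rs t.+1 + (beta - rhoz) / 2 * ms t <= Q t.
  by rewrite /E traj_y traj_z; exact: merit_ge_lagr.
have QM t : merit (xpart (w t.+1)) (ypart (w t.+1)) (zpart (w t.+1)) <=
    Q t + rhoy * rs t.+1 + rhoz * ms t.
  by rewrite traj_y traj_z; exact: merit_dual_step.
have QE t : 0 <= E t.+1 - (1 - a) * E t
    + (beta - rhoy) / 2 * rs t.+1 + (beta - rhoz) / 2 * ms t.
  by rewrite /E traj_y traj_z; exact: dual_dist_step_ge0.
have an : a * n%:R = 1 by rewrite /a mulVf// pnatr_eq0 -lt0n.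
have ab : a * (beta / 2) = beta / (2 * n%:R).
  by rewrite /a; field; rewrite pnatr_eq0 -lt0n.
have n1 : 1 <= n%:R :> R by rewrite ler1n.
have a1 : a <= 1 by rewrite -an ler_peMr// ltW.
have ry : rhoy <= a * beta by rewrite mulrC.
have rz : rhoz <= a * beta / 2.
  by apply: le_trans rhoz_le _; rewrite -mulrA ab.
(* The last iterate keeps the full weight through [Q k]; each induction step trades the fraction [a]
   of it for a Lagrangian value by [QL]. *)
have inv : Q k + wdist (xpart (w k.+1))
    + a * \sum_(t < k) lagr lam mu (xpart (w t.+1)) + a * (E k - E 0%N)
    <= (1 - a) * merit x0 0 0 + wdist x0 + \sum_(t < k.+1) gain (w t) (w t.+1).
  elim: k => [|k IH].
    rewrite big_ord_recl !big_ord0 !addr0 mulr0 subrr mulr0 !addr0.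
    rewrite /gain -/(Q 0%N) w0/= -/a.
    have : 0 <= beta / (2 * n%:R) * enorm (resid pb x0) ^+ 2.
      by rewrite mulr_ge0 ?sqr_ge0// divr_ge0 ?mulr_ge0// ltW.
    by lra.
  rewrite big_ord_recr/= [X in _ <= _ + X]big_ord_recr/=.
  have := QL k; have := QM k; move: IH.
  rewrite {3}/gain -/(Q k.+1) -/(rs k.+1) -/a -ab.
  move: (merit _ (ypart _) (zpart _)) => Mk.
  have := rs0 k.+1; have := ms0 k.
  move: (rs k.+1) (ms k) (Q k) => r s Qk s0 r0 IH QMk QLk.
  have QMk' : (1 - a) * Mk <= (1 - a) * (Qk + rhoy * r + rhoz * s).
    by rewrite ler_wpM2l// subr_ge0.
  have QLk' := ler_wpM2l (ltW a0) QLk.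
  (* The squared residuals gained from [QL] and from the surplus in [gain] outweigh those lost in
     the dual update. In [c2] there is no surplus, hence the stricter bound on rho_z. *)
  have c1 : 0 <= (a * (beta - rhoy) / 2 + a * beta / 2 - (1 - a) * rhoy) * r.
    apply: mulr_ge0 => //; have := mulr_ge0 (ltW a0) (ltW rhoy_gt0); lra.
  have c2 : 0 <= (a * (beta - rhoz) / 2 - (1 - a) * rhoz) * s.
    apply: mulr_ge0 => //; have := mulr_ge0 (ltW a0) (ltW rhoz_gt0); lra.
  by lra.
have D0 : 0 <= wdist (xpart (w k.+1)).
  rewrite /wdist mulr_ge0// sumr_ge0// => i _.
  by rewrite mulr_ge0 ?sqr_ge0// ltW.
have E0 : dual_dist lam mu 0 0 = E 0%N by rewrite /E w0.
(* [QE] supplies the nonnegativity of the distance terms left over beside - a * E 0. *)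
by have := QL k; have := QE k; rewrite E0; lra.
Qed.

Definition traj_avg k : X := (1 + k%:R / n%:R)^-1 *:
  (xpart (w k.+1) + n%:R^-1 *: \sum_(t < k) xpart (w t.+1)).

(** Its deterministic part equals [Cconst] by [CconstE]; the gains have nonpositive mean. *)
Definition traj_total k : R := (1 - n%:R^-1) * merit x0 0 0 + wdist x0
  + \sum_(t < k.+1) gain (w t) (w t.+1).

Lemma traj_avg_edom k : edom (hfun pb) (traj_avg k).
Proof.
have ninv : 0 <= n%:R^-1 :> R by rewrite invr_ge0.
have [_ _ [hp _ hc]] := pb_convex.
by have [] := jensen_lazy_average ninv
  (fun u v t => hsum_convex hp hc (x := u) (y := v) (t := t))
  (traj_edom k.+1) (fun t => traj_edom t.+1) k.
Qed.

Lemma traj_avg_bound k c (d : 'I_m -> R) : 0 <= c -> (forall j, 0 <= d j) ->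
  (1 + k%:R / n%:R) * (g (traj_avg k) + hsum pb (traj_avg k) - Fs
    + c * enorm (resid pb (traj_avg k)) + \sum_j d j * pospart (f j (traj_avg k)))
  <= traj_total k + n%:R^-1 * ((2 * rhoy)^-1 * c ^+ 2
       + (2 * rhoz)^-1 * \sum_j d j ^+ 2).
Proof.
move=> c0 d0; set xb := traj_avg k; set r := resid pb xb.
(* These multipliers maximise the penalty at the average under |lam| <= c and 0 <= mu j <= d j. If r
   = 0, both r and the quotient are 0, so lam = 0. *)
pose lam := (c / enorm r) *: r.
pose mu j : R := if 0 <= f j xb then d j else 0.
have mu0 j : 0 <= mu j by rewrite /mu; case: ifP.
have muf j : mu j * f j xb = d j * pospart (f j xb).
  by rewrite /mu /pospart; case: leP; rewrite ?mul0r ?mulr0.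
have lamr : dotv lam r = c * enorm r.
  rewrite dotvZl -enorm_sqr; have [->|r0] := eqVneq (enorm r) 0.
    by rewrite expr0n !mulr0.
  by field.
have lamc : enorm lam ^+ 2 <= c ^+ 2.
  rewrite enormZ normrM normfV (ger0_norm (enorm_ge0 r)) (ger0_norm c0).
  have [->|r0] := eqVneq (enorm r) 0; first by rewrite mulr0 expr0n sqr_ge0.
  by rewrite divfK.
have mud : \sum_j mu j ^+ 2 <= \sum_j d j ^+ 2.
  by apply: ler_sum => j _; rewrite /mu; case: ifP; rewrite ?expr0n ?sqr_ge0.
have ninv : 0 <= n%:R^-1 :> R by rewrite invr_ge0.
have [_ jb] := jensen_lazy_average ninv (lagr_convex lam mu0)
  (traj_edom k.+1) (fun t => traj_edom t.+1) k.
rewrite -/(traj_avg k) -/xb {1}/lagr -/r lamr in jb.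
rewrite -(eq_bigr _ (fun j _ => muf j)).
apply: le_trans jb _.
have tot : _ <= traj_total k := gain_sum_ge lam k mu0.
rewrite lerBlDr in tot; apply: le_trans tot _.
rewrite lerD2l ler_wpM2l// /dual_dist sub0r enormN.
rewrite (eq_bigr (fun j => mu j ^+ 2)) => [|j _]; last first.
  by rewrite mxE sub0r sqrrN.
by rewrite lerD// ler_wpM2l// invr_ge0 mulr_ge0// ltW.
Qed.

(** * Objective gap and infeasibility at the average *)

Section KKTBounds.
Variables (ys : 'cV[R]_q) (zs : 'cV[R]_m).
Context (ws_KKT : KKT pb (Iterate xs ys zs)) (xs_dom : edom (hfun pb) xs).

Let zs_ge0 j : 0 <= zs j 0.
Proof. by have [_ _ /(_ j)[]] := ws_KKT. Qed.

Lemma KKT_gap_ge x : edom (hfun pb) x ->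
  0 <= g x + hsum pb x - Fs + enorm ys * enorm (resid pb x)
    + \sum_j zs j 0 * pospart (f j x).
Proof.
move=> xd; have := lagr_KKT_ge0 ws_KKT xs_dom xd.
rewrite /lagr; have := dotv_le ys (resid pb x).
suff : \sum_j zs j 0 * f j x <= \sum_j zs j 0 * pospart (f j x) by lra.
by apply: ler_sum => j _; rewrite ler_wpM2l// /pospart le_max lexx orbT.
Qed.

Let W_gt0 k : 0 < 1 + k%:R / n%:R :> R.
Proof. by rewrite ltr_wpDr// divr_ge0. Qed.

Lemma traj_gap_le k :
  (1 + k%:R / n%:R) * (g (traj_avg k) + hsum pb (traj_avg k) - Fs) <= traj_total k.
Proof.
have := traj_avg_bound k (lexx 0) (fun _ => lexx 0).
rewrite big1 => [|j _]; last by rewrite mul0r.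
rewrite [X in _ <= _ + _ * (_ + _ * X)]big1 => [|j _]; last by rewrite expr0n.
by rewrite !(mul0r, mulr0, addr0, expr0n).
Qed.

(** Twice [KKT_gap_ge] says that the gap with penalties 2 |ys| and 2 zs is at least minus the gap;
    squaring these sizes produces the factor 2 in the constants. *)
Lemma traj_gap_ge k :
  (1 + k%:R / n%:R) * - (g (traj_avg k) + hsum pb (traj_avg k) - Fs) <=
  traj_total k + (2 * enorm ys ^+ 2 / (n%:R * rhoy)
                  + 2 * enorm zs ^+ 2 / (n%:R * rhoz)).
Proof.
have c0 : 0 <= 2 * enorm ys by rewrite mulr_ge0// enorm_ge0.
have d0 j : 0 <= 2 * zs j 0 by rewrite mulr_ge0.
have := traj_avg_bound k c0 d0.
rewrite (_ : \sum_j (2 * zs j 0) ^+ 2 = 4 * enorm zs ^+ 2); last first.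
  by rewrite enorm_sqr mulr_sumr; apply: eq_bigr => j _; ring.
rewrite (_ : n%:R^-1 * _ = 2 * enorm ys ^+ 2 / (n%:R * rhoy)
                  + 2 * enorm zs ^+ 2 / (n%:R * rhoz)); last first.
  by field; rewrite !gt_eqF// ltr0n.
apply: le_trans; rewrite ler_pM2l//.
move: (KKT_gap_ge (traj_avg_edom k)) => gap.
under [in leRHS]eq_bigr do rewrite -mulrA.
by rewrite -mulr_sumr; lra.
Qed.

(** Penalties exceeding |ys| and zs by one leave exactly the infeasibility after [KKT_gap_ge]. *)
Lemma traj_infeas_le k :
  (1 + k%:R / n%:R) * (enorm (resid pb (traj_avg k))
     + \sum_j pospart (f j (traj_avg k))) <=
  traj_total k + ((1 + enorm ys) ^+ 2 / (2 * n%:R * rhoy)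
     + (2 * n%:R * rhoz)^-1 * \sum_j (1 + zs j 0) ^+ 2).
Proof.
have c0 : 0 <= 1 + enorm ys by rewrite addr_ge0// enorm_ge0.
have d0 j : 0 <= 1 + zs j 0 by rewrite addr_ge0.
have := traj_avg_bound k c0 d0.
rewrite (_ : n%:R^-1 * _ = (1 + enorm ys) ^+ 2 / (2 * n%:R * rhoy)
     + (2 * n%:R * rhoz)^-1 * \sum_j (1 + zs j 0) ^+ 2); last first.
  by field; rewrite !gt_eqF// ltr0n.
apply: le_trans; rewrite ler_pM2l//.
move: (KKT_gap_ge (traj_avg_edom k)) => gap.
under [in leRHS]eq_bigr do rewrite mulrDl mul1r.
by rewrite big_split/=; lra.
Qed.

End KKTBounds.

End Trajectory.

End Pathwise.

(** * Uniform sampling of blocks *)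

Section UniformSampling.
Context {d : measure_display} {T : measurableType d} {R : realType}.
Variables (P : probability T R) (n : nat) (I : nat -> T -> 'I_n).
Context (n_gt0 : (0 < n)%N) (I_iid : iid_uniform P I).

Definition history_event (k : nat) (s : nat -> 'I_n) : set T :=
  [set om | forall t, (t < k)%N -> I t om = s t].

(** Pointwise form of measurability with respect to the first k draws; such a function takes
    finitely many values. *)
Definition depends_on_history (V : Type) (k : nat) (phi : T -> V) :=
  forall om om', (forall t, (t < k)%N -> I t om = I t om') -> phi om = phi om'.

Lemma history_eventE k s : history_event k s =
  \bigcap_(t in [set` seq_fset tt (iota 0 k)]) (I t @^-1` [set s t]).
Proof.
have Kt t : (t \in seq_fset tt (iota 0 k)) = (t < k)%N.
  by rewrite seq_fsetE mem_iota.
apply/seteqP; split=> om omE t /=; first by rewrite Kt; exact: omE.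
by rewrite -Kt; exact: omE.
Qed.

Lemma measurable_history_event k s : measurable (history_event k s).
Proof.
have [mI _ _] := I_iid; rewrite history_eventE.
by apply: fin_bigcap_measurable => // t _; exact: mI.
Qed.

Lemma prob_history_event k s : P (history_event k s) = (n%:R^-1 ^+ k)%:E.
Proof.
have [_ PI Pind] := I_iid; rewrite history_eventE Pind; congr EFin.
rewrite (perm_big _ (seq_fset_perm tt (iota 0 k))) undup_id ?iota_uniq//=.
under eq_bigr do rewrite PI /=.
by rewrite big_const_seq count_predT size_iota -Monoid.iteropE.
Qed.

(** Every history has positive probability, so a function of the history can be evaluated at a
    representative outcome. *)
Lemma history_event_nonempty k s : exists om, history_event k s om.
Proof.
apply/set0P/eqP => E0; have := prob_history_event k s; rewrite E0 measure0.
move=> [] /eqP; rewrite eq_sym expf_eq0 invr_eq0 pnatr_eq0 => /andP[_].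
by rewrite gtn_eqF.
Qed.

Definition history_ext k (s : {ffun 'I_k -> 'I_n}) (i : 'I_n) (t : nat) : 'I_n :=
  if insub t is Some u then s u else i.

Lemma history_ext_lt k s i (t : 'I_k) : history_ext s i t = s t.
Proof. by rewrite /history_ext valK. Qed.

Lemma history_ext_last k (s : {ffun 'I_k -> 'I_n}) i : history_ext s i k = i.
Proof. by rewrite /history_ext insubN// ltnn. Qed.

Definition history_rep k (p : {ffun 'I_k -> 'I_n} * 'I_n) : T :=
  sval (cid (history_event_nonempty k.+1 (history_ext p.1 p.2))).

Lemma history_rep_lt k p (t : 'I_k) : I t (history_rep p) = p.1 t.
Proof.
by rewrite /history_rep; case: cid => om /= ->; rewrite ?history_ext_lt// ltnW// ltnS.
Qed.

Lemma history_rep_last k (p : {ffun 'I_k -> 'I_n} * 'I_n) : I k (history_rep p) = p.2.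
Proof. by rewrite /history_rep; case: cid => om /= ->; rewrite ?history_ext_last. Qed.

(** The history is split into k past draws and the last one, so that the integral becomes an
    iterated sum suited to conditioning. *)
Lemma history_decomposition k (phi : T -> R) : depends_on_history k.+1 phi ->
  EFin \o phi = (fun om => \sum_(p : {ffun 'I_k -> 'I_n} * 'I_n)
    (phi (history_rep p))%:E * (\1_(history_event k.+1 (history_ext p.1 p.2)) om)%:E)%E.
Proof.
move=> dphi; apply/funext => om /=.
pose p0 := ([ffun t : 'I_k => I t om], I k om).
have omp0 : history_event k.+1 (history_ext p0.1 p0.2) om.
  move=> t; rewrite ltnS leq_eqVlt => /predU1P[->|tk]; first by rewrite history_ext_last.
  by rewrite (history_ext_lt _ _ (Ordinal tk)) ffunE.
rewrite (bigD1 p0)//= big1 ?adde0 => [|p pp0].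
  rewrite indicE mem_set// mule1; congr EFin; apply: dphi => t tk.
  rewrite omp0//; move: tk; rewrite ltnS leq_eqVlt => /predU1P[->|tk].
    by rewrite history_ext_last history_rep_last.
  by rewrite (history_ext_lt _ _ (Ordinal tk)) (history_rep_lt _ (Ordinal tk)).
rewrite indicE memNset ?mule0// => omp; move/eqP: pp0; apply.
apply: injective_projections => /=.
  by apply/ffunP => t; rewrite ffunE omp ?history_ext_lt// ltnW// ltnS.
by rewrite omp// history_ext_last.
Qed.

Lemma integrable_depends_on_history k (phi : T -> R) :
  depends_on_history k.+1 phi -> P.-integrable setT (EFin \o phi).
Proof.
move=> dphi; rewrite (history_decomposition dphi).
apply: integrable_sum => // p _; apply: integrableZl => //.
by apply: integrable_indic => //; exact: measurable_history_event.
Qed.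

Lemma integral_depends_on_history k (phi : T -> R) : depends_on_history k.+1 phi ->
  (\int[P]_om (phi om)%:E = (n%:R^-1 ^+ k.+1 *
     \sum_(s : {ffun 'I_k -> 'I_n}) \sum_i phi (history_rep (s, i)))%:E)%E.
Proof.
move=> dphi.
have mE p := measurable_history_event k.+1 (@history_ext k p.1 p.2).
have iE p := integrable_indic P (mE p).
have -> : (fun om => (phi om)%:E) = EFin \o phi by [].
rewrite (history_decomposition dphi) integral_sum// => [|p]; last exact: integrableZl.
under eq_bigr do rewrite integralZl// integral_indic// setIT.
rewrite pair_big/= mulr_sumr -sumEFin; apply: eq_bigr => -[s i] _.
by rewrite EFinM muleC; congr (_ * _)%E; exact: prob_history_event.
Qed.

(** Tower property: the outcomes [v i] share their first k draws and differ in draw k, so the inner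
    sum is n times a conditional mean. *)
Lemma integral_sample_le0 k (phi : T -> R) : depends_on_history k.+1 phi ->
  (forall v : 'I_n -> T,
    (forall i j t, (t < k)%N -> I t (v i) = I t (v j)) ->
    (forall i, I k (v i) = i) -> \sum_i phi (v i) <= 0) ->
  (\int[P]_om (phi om)%:E <= 0)%E.
Proof.
move=> dphi phi0; rewrite (integral_depends_on_history dphi) lee_fin.
rewrite mulr_ge0_le0 ?exprn_ge0 ?invr_ge0//; apply: sumr_le0 => s _.
apply: phi0 => [i j t tk|i]; last by rewrite history_rep_last.
by rewrite !(history_rep_lt _ (Ordinal tk)).
Qed.

Lemma integral_le_drift k (X : T -> R) (Y : nat -> T -> R) (c : R) :
  depends_on_history k.+1 X ->
  (forall t, depends_on_history t.+1 (Y t)) ->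
  (forall t, \int[P]_om (Y t om)%:E <= 0)%E ->
  (forall om, X om <= c + \sum_(t < k.+1) Y t om) ->
  (\int[P]_om (X om)%:E <= c%:E)%E.
Proof.
move=> dX dY Y0 XY.
have iX := integrable_depends_on_history dX.
have iY t := integrable_depends_on_history (dY t).
have ic : P.-integrable setT (EFin \o cst c) by exact: finite_measure_integrable_cst.
have iS : P.-integrable setT (fun om => \sum_(t < k.+1) (Y t om)%:E)%E.
  by apply: integrable_sum => // t _; exact: iY.
apply: (@le_trans _ _ (\int[P]_om (c%:E + \sum_(t < k.+1) (Y t om)%:E))%E).
  apply: le_integral => //; first exact: integrableD.
  by move=> om _; rewrite sumEFin -EFinD lee_fin.
rewrite integralD// integral_cst// [X in (_ * X)%E](_ : _ = 1%E); last first.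
  exact: probability_setT.
rewrite mule1.
rewrite integral_sum// => [|t]; last exact: iY.
by rewrite -[leRHS]adde0 leeD2l// sume_le0// => t _; exact: Y0.
Qed.

End UniformSampling.

(** * From trajectories to expectations *)

Lemma blalm_depends_on_history {R : realType} {n : nat} {p_ : 'I_n -> nat} {q m : nat}
    (pb : problem R p_ q m) {d : measure_display} {T : measurableType d}
    (I : nat -> T -> 'I_n) beta rhoy rhoz eta x0 (w : nat -> T -> iterate R p_ q m) :
  convex_problem pb -> (forall i, 0 < eta i) -> edom (hfun pb) x0 ->
  blalm_sequence pb I beta rhoy rhoz eta x0 w ->
  forall k, depends_on_history I k (w k).
Proof.
move=> pbc eta0 x0d wseq; elim=> [om om' _|k IH om om' omE].
  by rewrite (wseq om).1 (wseq om').1.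
have wk : w k om = w k om' by apply: IH => t tk; apply: omE; exact: ltnW.
have Ik : I k om = I k om' by exact: omE.
have [w0 ws] := wseq om; have [_ /(_ k) ws'] := wseq om'.
apply: (blalm_step_unique pbc eta0 _ (ws k)); last by rewrite wk Ik.
exact: (traj_edom pbc w0 ws x0d).
Qed.

(** A subgradient at a point where h is +oo would force h to be +oo everywhere. *)
Lemma KKT_edom {R : realType} {n : nat} {p_ : 'I_n -> nat} {q m : nat}
    (pb : problem R p_ q m) xs ys zs x : edom (hfun pb) x ->
  KKT pb (Iterate xs ys zs) -> edom (hfun pb) xs.
Proof.
move=> xd [[v vsub _] _ _]; rewrite /edom/= ltNge leye_eq; apply/negP => /eqP xsy.
by have := vsub x; rewrite xsy addye// leye_eq => /eqP xy; rewrite /edom/= xy in xd.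
Qed.

Lemma CconstE {R : realType} {n : nat} {p_ : 'I_n -> nat} {q m : nat}
    (pb : problem R p_ q m) beta eta x0 xs : 0 < beta -> convex_problem pb ->
  edom (hfun pb) x0 -> edom (hfun pb) xs ->
  Cconst pb beta eta x0 xs =
    ((1 - n%:R^-1) * merit pb beta xs x0 0 0 + wdist eta xs x0)%:E.
Proof.
move=> beta0 [_ _ [hp _ _]] x0d xsd.
rewrite /Cconst (f0E hp x0d) (f0E hp xsd) -EFinB -!EFinD; congr ((_ * _ + _)%:E).
rewrite /merit /Faug dot0v /Psi.
under [in RHS]eq_bigr do rewrite mxE psi0//.
by rewrite -mulr_sumr; ring.
Qed.

Theorem theorem4p2 (R : realType) (n : nat) (p_ : 'I_n -> nat) (q m : nat)
    (pb : problem R p_ q m)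
    (Lg : R) (L B : 'I_m -> R)
    (xs : 'cV[R]_(\sum_i p_ i)) (ys : 'cV[R]_q) (zs : 'cV[R]_m)
    (d : measure_display) (T : measurableType d) (P : probability T R)
    (I : nat -> T -> 'I_n)
    (beta rhoy rhoz : R) (eta : 'I_n -> R)
    (x0 : 'cV[R]_(\sum_i p_ i))
    (w : nat -> T -> iterate R p_ q m)
    (ell : nat -> iterate R p_ q m -> 'I_n -> R) (lbar : 'I_n -> R)
    (n_gt0 : (0 < n)%N)
    (pb_convex : convex_problem pb)
    (pb_lipschitz : lipschitz_bounded pb Lg L B)
    (ws_KKT : KKT pb (Iterate xs ys zs))
    (I_iid : iid_uniform P I)
    (beta_gt0 : 0 < beta)
    (eta_gt0 : forall i, 0 < eta i)
    (x0_dom : edom (hfun pb) x0)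
    (w_blalm : blalm_sequence pb I beta rhoy rhoz eta x0 w)
    (ell_ge0 : forall k om i, 0 <= ell k (w k om) i)
    (ell_lipschitz : forall k om i,
      block_lipschitz pb beta (w k om) i (ell k (w k om) i))
    (ell_le_lbar : forall k om i, ell k (w k om) i <= lbar i)
    (rhoy_gt0 : 0 < rhoy) (rhoy_le : rhoy <= beta / n%:R)
    (rhoz_gt0 : 0 < rhoz) (rhoz_le : rhoz <= beta / (2 * n%:R))
    (eta_ge : forall i,
      lbar i + beta * spectral_norm (submxrow (Amat pb) i) ^+ 2 <= eta i) :
  forall k : nat,
    (`| \int[P]_om (f0 pb (xavg w k om) - f0 pb xs) |
       <= ((1 + k%:R / n%:R)^-1)%:E *
            (Cconst pb beta eta x0 xs
             + (2 * enorm ys ^+ 2 / (n%:R * rhoy)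
                + 2 * enorm zs ^+ 2 / (n%:R * rhoz))%:E))%E
    /\
    ('E_P [fun om => (enorm (resid pb (xavg w k om))
                      + \sum_j pospart (fcon pb j (xavg w k om)))%R]
       <= ((1 + k%:R / n%:R)^-1)%:E *
            (Cconst pb beta eta x0 xs
             + ((1 + enorm ys) ^+ 2 / (2 * n%:R * rhoy)
                + (2 * n%:R * rhoz)^-1 * \sum_j (1 + zs j 0) ^+ 2)%:E))%E.
Proof.
move=> k.
have xsd := KKT_edom x0_dom ws_KKT.
have [_ Axs cs] := ws_KKT.
have fxs j : fcon pb j xs <= 0 by have [] := cs j.
have [_ _ [hp _ _]] := pb_convex.
pose ws om t := w t om.
have ws0 om : ws om 0%N = Iterate x0 0 0 by have [] := w_blalm om.
have wst om t : blalm_step pb beta rhoy rhoz eta (ws om t) (I t om) (ws om t.+1).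
  by have [_ /(_ t)] := w_blalm om.
have wdep := blalm_depends_on_history pb_convex eta_gt0 x0_dom w_blalm.
have wdep_le t t' : (t <= t')%N -> depends_on_history I t' (w t).
  by move=> tt' om om' omE; apply: wdep => s st; apply: omE; exact: leq_trans tt'.
have avgE om : xavg w k om = traj_avg (ws om) k by [].
have avg_dep : depends_on_history I k.+1 (xavg w k).
  move=> om om' omE; rewrite /xavg (wdep _ _ _ omE); congr (_ *: (_ + _ *: _)).
  by apply: eq_bigr => t _; rewrite (wdep_le t.+1 k.+1 (leqW (ltn_ord t)) _ _ omE).
have avgd om : edom (hfun pb) (xavg w k om).
  by rewrite avgE; exact: (traj_avg_edom pb_convex (ws0 om) (wst om) x0_dom).
pose W : R := 1 + k%:R / n%:R.
have W0 : 0 < W by rewrite ltr_wpDr// divr_ge0.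
(* The gains are divided by W beforehand, so that the drift bound applies to the averaged quantities
   themselves. *)
pose Y t om := W^-1 * gain pb beta eta xs (w t om) (w t.+1 om).
have Ydep t : depends_on_history I t.+1 (Y t).
  move=> om om' omE.
  by rewrite /Y (wdep_le _ _ (leqnSn t) _ _ omE) (wdep _ _ _ omE).
have Y0 t : (\int[P]_om (Y t om)%:E <= 0)%E.
  apply: (integral_sample_le0 n_gt0 I_iid (Ydep t)) => v vE vI.
  rewrite -mulr_sumr mulr_ge0_le0 ?invr_ge0 ?(ltW W0)//.
  pose i0 : 'I_n := Ordinal n_gt0.
  (* The outcomes agree before draw t, so they share the iterate [w t] and its block Lipschitz
     constants. *)
  have wv i : w t (v i) = w t (v i0) by apply: wdep => s st; exact: vE.
  under eq_bigr do rewrite wv.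
  apply: (@gain_sum_le0 _ _ _ _ _ pb beta rhoy rhoz eta xs n_gt0 beta_gt0 pb_convex
    (w t (v i0)) (fun i => w t.+1 (v i)) (ell t (w t (v i0))) lbar) => //.
    exact: (traj_edom pb_convex (ws0 _) (wst (v i0)) x0_dom).
  by move=> i; rewrite -(wv i) -{2}(vI i); exact: (wst (v i)).
have drift X c : depends_on_history I k.+1 X ->
    (forall om, W * X om <= traj_total pb beta eta xs (ws om) x0 k + c) ->
    (\int[P]_om (X om)%:E <= (W^-1)%:E * (Cconst pb beta eta x0 xs + c%:E))%E.
  move=> Xdep Xle; rewrite CconstE// -EFinD -EFinM.
  apply: (integral_le_drift n_gt0 I_iid Xdep Ydep Y0) => om.
  rewrite -mulr_sumr -mulrDr -ler_pdivrMl ?invr_gt0// invrK.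
  by rewrite [leRHS]addrAC; exact: Xle.
pose gap om := gfun pb (xavg w k om) + hsum pb (xavg w k om)
  - (gfun pb xs + hsum pb xs).
have gapE om : (f0 pb (xavg w k om) - f0 pb xs)%E = (gap om)%:E.
  by rewrite !f0E// -EFinB.
have gap_dep : depends_on_history I k.+1 gap.
  by move=> om om' omE; rewrite /gap (avg_dep _ _ omE).
have gap_int := integrable_depends_on_history n_gt0 I_iid gap_dep.
split; last first.
  rewrite unlock; apply: drift => [om om' omE|om]; first by rewrite (avg_dep _ _ omE).
  exact: (traj_infeas_le n_gt0 beta_gt0 pb_convex eta_gt0 rhoy_gt0 rhoy_le rhoz_gt0
    rhoz_le (ws0 om) (wst om) x0_dom ws_KKT xsd).
under eq_integral do rewrite gapE.
have gap_le : (\int[P]_om (gap om)%:E <= (W^-1)%:E * (Cconst pb beta eta x0 xs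
    + (2 * enorm ys ^+ 2 / (n%:R * rhoy) + 2 * enorm zs ^+ 2 / (n%:R * rhoz))%:E))%E.
  apply: drift => // om.
  have gap_le : W * gap om <= traj_total pb beta eta xs (ws om) x0 k :=
    traj_gap_le xs n_gt0 beta_gt0 pb_convex eta_gt0 rhoy_gt0 rhoy_le rhoz_gt0
      rhoz_le (ws0 om) (wst om) x0_dom k.
  apply: le_trans gap_le _; rewrite lerDl.
  have sq_div_ge0 (u r : R) : 0 < r -> 0 <= 2 * u ^+ 2 / (n%:R * r).
    by move=> /ltW r0; rewrite divr_ge0// mulr_ge0// sqr_ge0.
  by rewrite addr_ge0// sq_div_ge0.
(* The absolute value is outside the integral, so bounds on the means of the gap and of its negative
   suffice. *)
have gap_ge : (\int[P]_om (- gap om)%:E <= (W^-1)%:E * (Cconst pb beta eta x0 xs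
    + (2 * enorm ys ^+ 2 / (n%:R * rhoy) + 2 * enorm zs ^+ 2 / (n%:R * rhoz))%:E))%E.
  apply: drift => [om om' omE|om]; first by rewrite (gap_dep _ _ omE).
  exact: (traj_gap_ge n_gt0 beta_gt0 pb_convex eta_gt0 rhoy_gt0 rhoy_le rhoz_gt0
    rhoz_le (ws0 om) (wst om) x0_dom ws_KKT xsd).
have intN : (\int[P]_om (- gap om)%:E = - \int[P]_om (gap om)%:E)%E.
  under eq_integral do rewrite EFinN.
  by rewrite integralN//; exact: integrable_add_def.
rewrite intN in gap_ge.
have [I0|I0] := leP 0%E (\int[P]_om (gap om)%:E)%E; first by rewrite gee0_abs.
by rewrite lte0_abs.
Qed.
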